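(* Let $T,\theta,R>0$, $\alpha>1$, $\lambda,\mu>0$. Define $\eta(t)$ and $f_T(t)$ by $$\eta(t):=\int_0^t\frac{ds}{\bigl(1+\lambda(T-s)\bigr)^{\frac{\mu}{\lambda(\alpha-1)}+1}-1},$$ $$f_T(t):=\left(\frac{\mu+\lambda(\alpha-1)}{(\alpha-1)\left[\bigl(1+\lambda(T-t)\bigr)^{\frac{\mu}{\lambda(\alpha-1)}+1}-1\right]}\right)^{\alpha-1}\bigl(1+\lambda(T-t)\bigr)^{\frac{\mu}{\lambda}}\exp\left(-\alpha\left(\frac{\mu}{\alpha-1}+\lambda\right)\eta(t)\right).$$ When the discount function is the generalized hyperbolic one, $\gamma_t(s)=(1+\lambda(s-t))^{-\mu/\lambda}$, the agent's trajectory (defined in the context) is given by $$x(t)=\theta\left(1-\exp\left(-\left(\frac{\mu}{\alpha-1}+\lambda\right)\eta\bigl(\min(t,t^* )\bigr)\right)\right),$$ where $t^*$ is defined as follows: if there exists $t\in[0,T]$ such that $f_T(t)>\frac{R}{\theta^\alpha}$, then $t^*$ is the infimum of all such $t$; otherwise, $t^*=T$.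
   Context: An agent receives a reward $R$ if its progress reaches the goal $\theta$ within the period $[0,T]$. The agent's state is $(t,x)$, with time $t\in[0,T]$ and progress $x\ge0$. Cost function: $c(\Delta)=\Delta^\alpha$ if $\Delta\ge0$ and $c(\Delta)=+\infty$ otherwise. $\mathcal Y_{t,x}$ is the set of absolutely continuous functions $y$ on $[t,T]$ with $y(t)=x$. The perceived cost of $y\in\mathcal Y_{t,x}$ is $$\mathcal P[y]=\int_t^T\gamma_t(s)\,c(y'(s))\,ds-\gamma_t(T)\,R\cdot\mathbf 1[y(T)\ge\theta].$$ At state $(t,x)$ the agent selects $y^*_{t,x}:=\operatorname{argmin}_{y\in\mathcal Y_{t,x}}\mathcal P[y]$; if the minimizer is not unique, one that maximizes the initial derivative $\left.\frac{d\,y^*_{t,x}(s)}{ds}\right|_{s=t}$ is chosen. The agent's trajectory $x(t)$, $t\in[0,T]$, is determined by $$\frac{dx(t)}{dt}=\left.\frac{d\,y^*_{t,x(t)}(s)}{ds}\right|_{s=t},\qquad x(0)=0.$$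
   Formalization: The equation for dx/dt is required at every t in [0,T) except the single instant t*, with x continuous on [0,T]: when 0<t*<T the closed form has a kink at t* while the tie-break selects a positive speed, so no function satisfies the equation there. *)

(* Defs.v *)
From HB Require Import structures.
From mathcomp Require Import all_boot all_order all_algebra.
From mathcomp Require Import all_classical all_reals all_analysis.

Set Implicit Arguments.
Unset Strict Implicit.
Unset Printing Implicit Defensive.

Import Order.TTheory GRing.Theory Num.Theory.
Import numFieldNormedType.Exports.

Local Open Scope classical_set_scope.
Local Open Scope ring_scope.

(* A function on a segment [a, b] is represented by a total f : R -> R of which
   only the values on [a, b] matter. *)

Definition abs_continuous_on (R : realType) (a b : R) (f : R -> R) : Prop :=
  forall e : R, 0 < e -> exists2 d : R, 0 < d &
    forall (n : nat) (u v : 'I_n -> R),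
      (forall i, a <= u i /\ u i <= v i /\ v i <= b) ->
      trivIset setT (fun i => [set` `]u i, v i[]) ->
      \sum_(i < n) (v i - u i) < d ->
      \sum_(i < n) `|f (v i) - f (u i)| < e.

(* Derivative of f : [a, b] -> R at t: two-sided when a < t < b, one-sided at an
   endpoint. *)
Definition has_derivative_on (R : realType) (a b : R) (f : R -> R) (t v : R)
    : Prop :=
  (f s - f t) / (s - t) @[s --> within `[a, b] t^'] --> v.

Definition effort_cost (R : realType) (alpha v : R) : \bar R :=
  if 0 <= v then (v `^ alpha)%:E else +oo%E.

Section Agent.
Context (R : realType).
Variables (T theta reward alpha : R) (gamma : R -> R -> R).

Definition plan (t x : R) (y : R -> R) : Prop :=
  abs_continuous_on t T y /\ y t = x.

(* The library derivative derive1 is two-sided and total. An absolutely continuous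
   y is differentiable almost everywhere, so neither the endpoints of [t, T] nor
   the default value of derive1 y where y has no derivative affect the integral. *)
Definition perceived_cost (t : R) (y : R -> R) : \bar R :=
  (\int[lebesgue_measure]_(s in `[t, T])
      ((gamma t s)%:E * effort_cost alpha (derive1 y s))
   - (gamma t T * reward * (theta <= y T)%R%:R)%:E)%E.

Definition optimal_plan (t x : R) (y : R -> R) : Prop :=
  plan t x y /\
  forall z, plan t x z -> (perceived_cost t y <= perceived_cost t z)%E.

(* v is the initial derivative of the plan selected at (t, x): a minimizer with,
   in case of ties, the largest initial derivative. *)
Definition chosen_speed (t x v : R) : Prop :=
  exists y, [/\ optimal_plan t x y, has_derivative_on t T y t v &
    forall z w, optimal_plan t x z -> has_derivative_on t T z t w -> w <= v].

(* The equation is required at every time of [0, T[ outside E. At T itself there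
   is no time left to plan, and x T is fixed by continuity. The set E serves for
   the instant at which the agent gives up: the trajectory then has a kink
   and no classical derivative. *)
Definition trajectory_off (E : set R) (x : R -> R) : Prop :=
  [/\ {within `[0, T], continuous x}, x 0 = 0 &
    forall t, 0 <= t < T -> ~ E t ->
      exists2 v, has_derivative_on 0 T x t v & chosen_speed t (x t) v].

End Agent.

Definition hyperbolic_discount (R : realType) (lambda mu t s : R) : R :=
  (1 + lambda * (s - t)) `^ (- (mu / lambda)).

Section ClosedForm.
Context (R : realType).
Variables (T theta reward alpha lambda mu : R).

(* Extended-real valued since the integral diverges at T: eta T = +oo, and
   exp (- c * eta T) below is then expeR -oo = 0. *)
Definition eta (t : R) : \bar R :=
  (\int[lebesgue_measure]_(s in `[0%R, t])
    (((1 + lambda * (T - s)) `^ (mu / (lambda * (alpha - 1)) + 1) - 1)^-1)%:E)%E.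

(* At t = T the base has denominator 0; the total division and expeR -oo = 0 give
   fT T = 0, which is also the limit of fT at T. *)
Definition fT (t : R) : R :=
  ((mu + lambda * (alpha - 1)) /
     ((alpha - 1) *
      ((1 + lambda * (T - t)) `^ (mu / (lambda * (alpha - 1)) + 1) - 1)))
    `^ (alpha - 1) *
  (1 + lambda * (T - t)) `^ (mu / lambda) *
  fine (expeR (- ((alpha * (mu / (alpha - 1) + lambda))%:E * eta t))%E).

Definition give_up_times : set R :=
  [set t | 0 <= t <= T /\ reward / theta `^ alpha < fT t].

Definition tstar : R :=
  if `[< exists t, give_up_times t >] then inf give_up_times else T.

Definition closed_form (t : R) : R :=
  theta * (1 - fine (expeR
    (- ((mu / (alpha - 1) + lambda)%:E * eta (Num.min t tstar)))%E)).

End ClosedForm.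

(* Main.v *)
(* At a state (t, x) with x < theta, write c for the speed profile proportional
   to gamma_t^(-1/(alpha-1)) that reaches theta exactly at T. The tangent to
   v |-> v^alpha at c(s), weighted by gamma_t(s), has a slope independent of s;
   hence its integral along a plan depends only on the endpoints of the plan, and
   c is optimal among the plans that reach theta. Applying the tangent bound with
   two slopes, before and after a time s, shows that the minimizer is unique. This
   needs the fundamental theorem of calculus for absolutely continuous plans, which
   comes from the Jordan decomposition into two monotone absolutely continuous
   functions, their Radon-Nikodym densities and Lebesgue differentiation.

   The agent therefore works at speed (theta - x) u(t) as long as
   (theta - x)^alpha h(t) <= R, and stops otherwise. While it works,
   theta - x = theta exp(- int u); since h increases, stopping is absorbing, and
   fT(t) is the value of (theta - x)^alpha h(t) / theta^alpha along the working
   trajectory. Conversely, a trajectory cannot stop before t*: at its last working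
   instant the derivative would be both positive and zero. *)

Require Import Defs.
From HB Require Import structures.
From mathcomp Require Import all_boot all_order all_algebra.
From mathcomp Require Import all_classical all_reals all_analysis.
From mathcomp Require Import measurable_realfun ring lra.
Import Order.TTheory GRing.Theory Num.Theory.
Import numFieldNormedType.Exports.
Local Open Scope classical_set_scope.
Local Open Scope ring_scope.

Set Implicit Arguments.
Unset Strict Implicit.
Unset Printing Implicit Defensive.

(** * Total variation of absolutely continuous functions *)

(** Origin of u and h: let w = gamma_t^(-1/(alpha - 1)), which is 1 at t, and let W be its primitive
    that vanishes at t. The cheapest plan to the goal has speed (theta - x) w(s) / W(T) and effort
    (theta - x)^alpha W(T)^(1 - alpha). Hence u(t) = 1 / W(T), and comparing the effort with
    gamma_t(T) R gives h(t) = u(t)^(alpha - 1) / gamma_t(T). Two obstacles shape the proof. A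
    competing plan is only absolutely continuous and [derive1] is total, so the running cost is
    bounded below through an integrable density that agrees with the derivative off a null set.
    Next, the speed as a function of the state jumps across (theta - x)^alpha h(t) = R, is described
    only for x < theta, and is not prescribed at t*. A Lipschitz uniqueness theorem is therefore out
    of reach; uniqueness rests on monotone quantities along an arbitrary trajectory, with continuity
    bridging the excepted instant. *)

(** The pieces of several partitions are naturally indexed by a sigma type, not by an ordinal. *)
Lemma abs_continuous_fin (R : realType) (a b : R) (f : R -> R) :
  abs_continuous_on a b f ->
  forall e, 0 < e -> exists2 d, 0 < d &
    forall (I : finType) (u v : I -> R),
      (forall i, a <= u i /\ u i <= v i /\ v i <= b) ->
      trivIset setT (fun i => [set` `]u i, v i[]) ->
      \sum_i (v i - u i) < d ->
      \sum_i `|f (v i) - f (u i)| < e.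
Proof.
move=> acf e e0; have [d d0 H] := acf _ e0; exists d => // I u v uv tuv.
have E (F : I -> R) : \sum_i F i = \sum_(i < #|I|) F (enum_val i).
  by rewrite -(@big_enum_val _ _ _ _ [pred x : I | true]).
rewrite !E => sd.
apply: (H #|I| (u \o enum_val) (v \o enum_val)) => [i|i j _ _ ij|//].
  exact: uv.
by apply: enum_val_inj; exact: tuv.
Qed.

Section variation.
Variables (R : realType) (a b : R) (f : R -> R).

Lemma itv_partition_nth_lt (c d : R) s i j : itv_partition c d s ->
  (i < j)%N -> (j <= size s)%N -> nth d (c :: s) i < nth d (c :: s) j.
Proof.
move=> [cs _] ij js.
have srt : sorted <%R (c :: s) by [].
by apply: (sorted_ltn_nth lt_trans d srt) => //=; rewrite inE ?ltnS // (leq_trans _ js)// ltnW.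
Qed.

Lemma itv_partition_trivIset (c d : R) s : itv_partition c d s ->
  trivIset setT (fun k : 'I_(size s) =>
    [set` `]nth d (c :: s) k, nth d (c :: s) k.+1[]).
Proof.
move=> cds i j _ _ [x []] /=; rewrite !in_itv /= => /andP[ix xi] /andP[jx xj].
have H (k l : 'I_(size s)) : (k < l)%N ->
    nth d (c :: s) l < x -> x < nth d (c :: s) k.+1 -> False.
  move=> kl lx xk; have := lt_trans lx xk.
  apply/negP; rewrite -leNgt.
  move: kl; rewrite leq_eqVlt => /predU1P[->//|kl].
  by apply/ltW/itv_partition_nth_lt => //; exact: ltnW.
apply: ord_inj; apply/eqP; rewrite eqn_leq; apply/andP; split; rewrite leqNgt; apply/negP => ij.
- exact: (H _ _ ij).
- exact: (H _ _ ij).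
Qed.

Lemma itv_partition_telescope (c d : R) s : itv_partition c d s ->
  \sum_(k < size s) (nth d (c :: s) k.+1 - nth d (c :: s) k) = d - c.
Proof.
move=> cds; rewrite -(big_mkord predT (fun k => nth d (c :: s) k.+1 - nth d (c :: s) k)).
by rewrite telescope_sumr// (itv_partition_nth_size _ cds).
Qed.

Hypothesis acf : abs_continuous_on a b f.

(** Refining disjoint intervals by partitions keeps the pieces disjoint and the total length
    unchanged, so the same [d] serves for all partitions. *)
Lemma abs_continuous_variation (e : R) : 0 < e -> exists2 d : R, 0 < d &
  forall (n : nat) (u v : 'I_n -> R) (s : 'I_n -> seq R),
    (forall i, a <= u i /\ u i <= v i /\ v i <= b) ->
    trivIset setT (fun i => [set` `]u i, v i[]) ->
    (forall i, itv_partition (u i) (v i) (s i)) ->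
    \sum_(i < n) (v i - u i) < d ->
    \sum_(i < n) variation (u i) (v i) f (s i) < e.
Proof.
move=> e0; have [d d0 H] := abs_continuous_fin acf e0.
exists d => // n u v s uv tuv ps sd.
pose I := {i : 'I_n & 'I_(size (s i))}.
pose U (p : I) := nth (v (tag p)) (u (tag p) :: s (tag p)) (tagged p).
pose V (p : I) := nth (v (tag p)) (u (tag p) :: s (tag p)) (tagged p).+1.
have E (F : forall i : 'I_n, 'I_(size (s i)) -> R) :
    \sum_(i < n) \sum_(k < size (s i)) F i k = \sum_(p : I) F (tag p) (tagged p).
  by rewrite (@sig_big_dep _ _ _ _ (fun i => 'I_(size (s i))) predT (fun _ => predT) F).
rewrite [ltLHS](_ : _ = \sum_(p : I) `|f (V p) - f (U p)|); last first.
  rewrite -(E (fun i k => `|f (nth (v i) (u i :: s i) k.+1) - f (nth (v i) (u i :: s i) k)|)).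
  by apply: eq_bigr => i _; rewrite /variation big_mkord.
have UV p : u (tag p) <= U p /\ U p < V p /\ V p <= v (tag p).
  split; first by apply: itv_partition_nth_ge (ps _); rewrite ltnS ltnW.
  split; last by apply: itv_partition_nth_le (ps _); rewrite ltnS.
  by apply: itv_partition_nth_lt (ps _) _ _.
apply: H => [p|p q _ _ [x [Hp Hq]]|].
- have [h1 [h2 h3]] := UV p; have [k1 [k2 k3]] := uv (tag p).
  by split; [exact: (le_trans k1)|split; [exact: ltW|exact: (le_trans h3)]].
- have pq : tag p = tag q.
    apply: tuv => //; exists x; split; rewrite /= in_itv/=.
      move: Hp; rewrite /= in_itv/= => /andP[h1 h2]; have [k1 [k2 k3]] := UV p.
      by rewrite (le_lt_trans k1 h1) (lt_le_trans h2 k3).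
    move: Hq; rewrite /= in_itv/= => /andP[h1 h2]; have [k1 [k2 k3]] := UV q.
    by rewrite (le_lt_trans k1 h1) (lt_le_trans h2 k3).
  case: p q pq Hp Hq => [i k] [j l] /= ij; subst j => Hp Hq.
  congr existT.
  by apply: (itv_partition_trivIset (ps i)) => //; exists x.
- apply: le_lt_trans sd.
  rewrite -(E (fun i k => nth (v i) (u i :: s i) k.+1 - nth (v i) (u i :: s i) k)).
  by apply: ler_sum => i _; rewrite itv_partition_telescope.
Qed.

Lemma abs_continuous_BV : a <= b -> bounded_variation a b f.
Proof.
move=> ab.
have [d d0 H] := abs_continuous_variation ltr01.
have step c x : a <= c -> c <= x -> x <= b -> x - c < d ->
    bounded_variation c x f.
  move=> ac cx xb xcd; exists 1 => _ [s cxs <-].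
  have := H 1%N (fun=> c) (fun=> x) (fun=> s).
  rewrite !big_ord1 => /(_ _ _ _ xcd) h; apply/ltW/h => // i j _ _ _.
  by rewrite !ord1.
(* Induction on the number of steps of length [d / 2]: on an interval shorter than [d] every
   variation is at most 1. *)
have claim k x : a <= x -> x <= b -> x <= a + (d / 2) *+ k ->
    bounded_variation a x f.
  elim: k x => [x ax xb|k ih x ax xb xk].
    rewrite mulr0n addr0 => xa; have -> : x = a by apply/le_anti/andP.
    exact: bounded_variationxx.
  have [xa|xa] := lerP (x - d / 2) a.
    by apply: step => //; lra.
  set c := x - d / 2 in xa.
  have cx : c <= x by rewrite /c; lra.
  apply/bounded_variationP => //; rewrite (total_variationD f (ltW xa) cx).
  rewrite fin_numD; apply/andP; split; apply/bounded_variationP => //.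
  - exact: ltW.
  - apply: ih; [exact: ltW|exact: le_trans xb|].
    by move: xk; rewrite mulrS /c; lra.
  - by apply: step => //; [exact: ltW|rewrite /c; lra].
pose k := Num.bound ((b - a) / (d / 2)).
apply: (claim k) => //; rewrite -lerBlDl -mulr_natr mulrC -ler_pdivrMr ?divr_gt0//.
by apply/ltW/archi_boundP; rewrite divr_ge0 ?subr_ge0 ?divr_ge0 // ltW.
Qed.

Lemma total_variation_fin (x y : R) : a <= x -> x <= y -> y <= b ->
  total_variation x y f \is a fin_num.
Proof.
move=> ax xy yb; apply/bounded_variationP => //.
have xb := le_trans xy yb.
apply: (bounded_variationl xy yb); apply: (bounded_variationr ax xb).
exact/abs_continuous_BV/(le_trans ax).
Qed.

Lemma total_variation_fineB (x y : R) : a <= x -> x <= y -> y <= b ->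
  fine (total_variation a y f) - fine (total_variation a x f) =
  fine (total_variation x y f).
Proof.
move=> ax xy yb; have xb := le_trans xy yb.
by rewrite (total_variationD f ax xy) fineD ?total_variation_fin// addrC addKr.
Qed.

Lemma total_variation_abs_continuous :
  abs_continuous_on a b (fun x => fine (total_variation a x f)).
Proof.
move=> e e0; have e20 : 0 < e / 2 by rewrite divr_gt0.
have [d d0 H] := abs_continuous_variation e20.
exists d => // n u v uv tuv sd.
(* Each total variation is approached by a partition within this error. The [n] errors add up to at
   most [e / 2], and [n.+1] keeps the quotient meaningful for [n = 0]. *)
have ndgt0 : 0 < e / 2 / n.+1%:R by rewrite divr_gt0.
have /choice[s ps] (i : 'I_n) : exists s, itv_partition (u i) (v i) s /\
    fine (total_variation (u i) (v i) f) <=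
      variation (u i) (v i) f s + e / 2 / n.+1%:R.
  have [ui [uvi vi]] := uv i.
  have fin := total_variation_fin ui uvi vi.
  have [_ [_ [s ss <-] <-] hs] := ub_ereal_sup_adherent ndgt0 fin.
  exists s; split => //; rewrite -lerBlDr -lee_fin EFinB fineK//.
  exact: ltW.
have := H n u v s uv tuv (fun i => (ps i).1) sd => sv.
rewrite (eq_bigr (fun i => fine (total_variation (u i) (v i) f))); last first.
  move=> i _; have [ui [uvi vi]] := uv i; rewrite total_variation_fineB//.
  by rewrite ger0_norm// fine_ge0// total_variation_ge0.
apply: (@le_lt_trans _ _ (\sum_(i < n) (variation (u i) (v i) f (s i) + e / 2 / n.+1%:R))).
  by apply: ler_sum => i _; exact: (ps i).2.
rewrite big_split/= sumr_const card_ord -[X in _ + X]mulr_natr.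
rewrite [ltRHS](splitr e); apply: ltr_leD => //.
by rewrite mulrAC ler_pdivrMr// ler_pM2l// ler_nat.
Qed.

End variation.

(** * Densities of monotone absolutely continuous functions *)

Lemma abs_continuous_dist (R : realType) (a b : R) (f : R -> R) :
  abs_continuous_on a b f ->
  forall e, 0 < e -> exists2 d, 0 < d &
    forall u v, a <= u -> u <= v -> v <= b -> v - u < d -> `|f v - f u| < e.
Proof.
move=> acf e e0; have [d d0 H] := acf _ e0; exists d => // u v au uv vb uvd.
have := H 1%N (fun=> u) (fun=> v); rewrite !big_ord1; apply => // i j _ _ _.
by rewrite !ord1.
Qed.

Lemma lebesgue_stieltjes_itv_oc (R : realType) (G : cumulative R R) (u v : R) :
  u <= v -> lebesgue_stieltjes_measure G `]u, v] = (G v - G u)%:E.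
Proof.
move=> uv; rewrite /lebesgue_stieltjes_measure /measure_extension/=.
rewrite measurable_mu_extE//; last exact: is_ocitv.
exact: wlength_itv_bnd.
Qed.

Section clamp.
Variables (R : realType) (a b : R).

(** Composing with this projection extends a function on [a, b] by constants, as a Stieltjes measure
    needs a monotone function on the whole line. *)
Definition clamp (x : R) : R := Num.max a (Num.min x b).

Lemma clamp_ge x : a <= clamp x.
Proof. by rewrite /clamp le_max lexx. Qed.

Lemma clamp_le x : a <= b -> clamp x <= b.
Proof. by move=> ab; rewrite /clamp ge_max ab/= ge_min lexx orbT. Qed.

Lemma clamp_id x : a <= x -> x <= b -> clamp x = x.
Proof. by move=> ax xb; rewrite /clamp (min_idPl xb) (max_idPr ax). Qed.

Lemma clamp_homo x y : x <= y -> clamp x <= clamp y.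
Proof.
by move=> xy; rewrite /clamp ge_max !le_max lexx/= le_min !ge_min xy lexx !orbT.
Qed.

Lemma clamp_left x : a <= b -> x <= a -> clamp x = a.
Proof.
move=> ab xa; apply/le_anti; rewrite clamp_ge andbT.
by rewrite -[leRHS](clamp_id (lexx a) ab) clamp_homo.
Qed.

Lemma clamp_right x : a <= b -> b <= x -> clamp x = b.
Proof.
move=> ab bx; apply/le_anti; rewrite clamp_le//=.
by rewrite -[leLHS](clamp_id ab (lexx b)) clamp_homo.
Qed.

Lemma clamp_lipschitz x y : x <= y -> clamp y - clamp x <= y - x.
Proof.
move=> xy; rewrite lerBlDr ge_max; apply/andP; split.
  by have := clamp_ge x; lra.
have : Num.min x b <= clamp x by rewrite /clamp le_max lexx orbT.
by case: (leP x b) => ?; case: (leP y b) => ?; lra.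
Qed.

End clamp.

Section monotone.
Variables (R : realType) (a b : R) (G : R -> R).
Hypotheses (ab : a <= b) (ndG : nondecreasing G) (acG : abs_continuous_on a b G).
Hypotheses (Ga : forall x, x <= a -> G x = G a) (Gb : forall x, b <= x -> G x = G b).
Let mu : measure _ _ := @lebesgue_measure R.

Let contG : continuous G.
Proof.
move=> x; apply/cvgrPdist_lt => e e0.
have [d d0 H] := abs_continuous_dist acG e0.
have Gc y : G y = G (clamp a b y).
  have [ya|ay] := leP y a; first by rewrite clamp_left// Ga.
  have [yb|yb] := leP b y; first by rewrite clamp_right// Gb.
  by rewrite clamp_id// ltW.
near=> y; have xy : `|x - y| < d by near: y; exact: cvgr_dist_lt.
rewrite (Gc x) (Gc y); move: xy; case: (leP x y) => xy yd.
  rewrite distrC; apply: H; [exact: clamp_ge|exact: clamp_homo|exact: clamp_le|].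
  apply: le_lt_trans (clamp_lipschitz _ _ xy) _; apply: le_lt_trans yd.
  by rewrite distrC ler_norm.
apply: H; [exact: clamp_ge|exact/clamp_homo/ltW|exact: clamp_le|].
apply: le_lt_trans (clamp_lipschitz _ _ (ltW xy)) _; apply: le_lt_trans yd.
by rewrite ler_norm.
Unshelve. all: by end_near. Qed.

Let GC : cumulative R R :=
  HB.pack G (isCumulative.Build R _ R G ndG (right_continuousW contG)).

Let muG : measure _ _ := lebesgue_stieltjes_measure GC.

Let muG_oc u v : u <= v -> muG `]u, v]%classic = (G v - G u)%:E.
Proof. by move=> uv; exact: (@lebesgue_stieltjes_itv_oc _ GC). Qed.

(* The components of an open set cut by ]a, b] have no minimum, so they lie in
   ]inf, sup], whose Stieltjes measure is an increment of G. *)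
Let itv_small (J : set R) : is_interval J -> J `<=` `]a, b] ->
  (forall x, J x -> exists2 y, y < x & J y) -> measurable J ->
  exists c d, [/\ a <= c, c <= d, d <= b, `]c, d[ `<=` J &
    (muG J <= (G d - G c)%:E)%E /\ ((d - c)%:E <= mu J)%E].
Proof.
move=> iJ Jab Jl mJ; have [->|/set0P J0] := eqVneq J set0.
  exists a, a; rewrite !subrr; split => //; last by rewrite !measure0. 
  by move=> x; rewrite /= in_itv/= => /andP[h1 h2]; move: (lt_trans h1 h2); rewrite ltxx.
have lbJ : has_lbound J by exists a => x /Jab; rewrite /= in_itv/= => /andP[/ltW].
have ubJ : has_ubound J by exists b => x /Jab; rewrite /= in_itv/= => /andP[].
have Jcd : `]inf J, sup J[ `<=` J.
  move=> x; rewrite /= in_itv/= => /andP[xi xs].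
  have [y Jy yx] : exists2 y, J y & y < x by exact: (inf_lt J0 xi).
  have [z Jz xz] : exists2 z, J z & x < z by exact: (sup_gt J0 xs).
  by apply: (iJ y z) => //; rewrite !ltW.
have JD : J `<=` `]inf J, sup J].
  move=> x Jx; rewrite /= in_itv/= ub_le_sup// andbT.
  by have [y yx Jy] := Jl _ Jx; rewrite (le_lt_trans _ yx)// ge_inf.
have cd : inf J <= sup J.
  by have [x Jx] := J0; apply: (@le_trans _ _ x); [exact: ge_inf|exact: ub_le_sup].
exists (inf J), (sup J); split => //.
- by apply: lb_le_inf => // x /Jab; rewrite /= in_itv/= => /andP[/ltW].
- by apply: sup_le_ub => // x /Jab; rewrite /= in_itv/= => /andP[].
split.
  by rewrite -muG_oc//; apply: le_measure; rewrite ?inE//; exact: measurable_itv.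
rewrite (_ : (sup J - inf J)%:E = mu `]inf J, sup J[%classic); last first.
  apply/esym/(etrans (lebesgue_measure_itv _)); rewrite /= lte_fin.
  by case: ltgtP cd => // ->; rewrite subrr.
by apply: le_measure; rewrite ?inE//; exact: measurable_itv.
Qed.

(** A null set lies in an open set of measure less than [d]. Its components, cut by ]a, b], are
    disjoint intervals of total length less than [d]. Absolute continuity handles finitely many of
    them at a time, so it bounds every partial sum of their Stieltjes measures by [e], and then the
    limit. *)
Let muG_dominated (A : set (measurableTypeR R)) : measurable A -> mu A = 0%E ->
  muG (A `&` `]a, b]%classic) = 0%E.
Proof.
move=> mA A0; apply/eqP; rewrite eq_le measure_ge0 andbT.
apply/lee_addgt0Pr => e e0; rewrite add0e.
have [d d0 H] := acG e0.
have [|U [oU AU Ud]] := @lebesgue_regularity_outer R A _ mA _ d0; first by rewrite -/mu A0.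
have mU : measurable U by exact: open_measurable.
(* Regularity bounds the measure of [U] outside [A]; as [A] is null, this bounds the measure of
   [U]. *)
have {}Ud : (mu U < d%:E)%E.
  apply: le_lt_trans Ud; rewrite [leLHS](@measureDI _ _ _ mu U A)//.
  rewrite [X in (_ + X)%E](_ : _ = 0%E) ?adde0//.
  apply/eqP; rewrite eq_le measure_ge0 andbT -A0.
  by apply: le_measure; rewrite ?inE//; exact: measurableI.
pose I := open_disjoint_itv oU.
have mI q : measurable (I q) by apply: open_measurable; exact: open_disjoint_itv_open.
pose J q := I q `&` `]a, b].
have mJ q : measurable (J q) by apply: measurableI => //; exact: measurable_itv.
have tJ : trivIset setT J.
  by apply: trivIset_setIr; exact: open_disjoint_itv_trivIset.
have /choice[c /choice[w cw]] q : exists c d, [/\ a <= c, c <= d, d <= b, `]c, d[ `<=` J q &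
    (muG (J q) <= (G d - G c)%:E)%E /\ ((d - c)%:E <= mu (J q))%E].
  apply: itv_small => //.
  - move=> x y [Ix /= xab] [Iy yab] z xzy; split.
      exact: (open_disjoint_itv_is_interval Ix Iy xzy).
    move: xab yab xzy; rewrite /= !in_itv/= => /andP[ax _] /andP[_ yb] /andP[xz zy].
    by rewrite (lt_le_trans ax xz) (le_trans zy yb).
  - by move=> x [].
  - move=> x [Ix xab].
    have : nbhs x (I q) by apply: open_nbhs_nbhs; split => //; exact: open_disjoint_itv_open.
    move: xab; rewrite /= in_itv/= => /andP[ax xb] nI.
    have [r /= r0 rI] := (nbhs_ballP _ _).1 nI.
    (* A point to the left of [x] that stays both in the ball around [x] and to the right of [a]. *)
    exists (Num.max (x - r / 2) ((a + x) / 2)).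
      by rewrite gt_max; apply/andP; split; lra.
    split.
      apply: rI; rewrite /ball/= ger0_norm; last first.
        by rewrite subr_ge0 ge_max; apply/andP; split; lra.
      by case: (leP (x - r / 2) ((a + x) / 2)) => ?; lra.
    by rewrite /= in_itv/= lt_max ge_max; apply/andP; split;
      [apply/orP; right; lra|apply/andP; split; lra].
apply: (@le_trans _ _ (muG (\bigcup_q J q))).
  apply: le_measure; rewrite ?inE.
  - by apply: measurableI => //; exact: measurable_itv.
  - by apply: bigcup_measurable => q _; exact: mJ.
  - move=> x [Ax xab]; have := AU _ Ax.
    by rewrite (open_disjoint_itv_bigcup oU) => -[q _ Iqx]; exists q.
rewrite measure_bigcup; [|by move=> q _; exact: mJ|exact: tJ].
apply: lime_le; first by apply: is_cvg_nneseries => *; exact: measure_ge0.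
near=> n.
apply: (@le_trans _ _ (\sum_(0 <= q < n) (G (w q) - G (c q))%:E)%E).
  rewrite (eq_bigl xpredT); last by move=> q; rewrite in_setT.
  by apply: lee_sum => q _; have [_ _ _ _ []] := cw q.
rewrite big_mkord sumEFin lee_fin; apply/ltW.
have cwab q : a <= c q /\ c q <= w q /\ w q <= b by have [] := cw q.
have -> : \sum_(q < n) (G (w q) - G (c q)) = \sum_(q < n) `|G (w q) - G (c q)|.
  by apply: eq_bigr => q _; rewrite ger0_norm// subr_ge0 ndG//; have [_ []] := cwab q.
apply: (H n (c \o val) (w \o val)) => [q|p q _ _ [x [/= xp xq]]|].
- exact: cwab.
- apply: val_inj; apply: tJ => //; exists x; split.
    by have [_ _ _ + _] := cw (val p); apply.
  by have [_ _ _ + _] := cw (val q); apply.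
- rewrite -lte_fin -sumEFin; apply: le_lt_trans Ud.
  apply: (@le_trans _ _ (\sum_(q < n) mu (J q))%E).
    by apply: lee_sum => q _; have [_ _ _ _ []] := cw (val q).
  rewrite -(@measure_bigsetU _ _ _ mu J mJ tJ n).
  apply: le_measure; rewrite ?inE; [by apply: bigsetU_measurable => q _; exact: mJ|exact: mU|].
  rewrite -bigcup_mkord => x [q _ [Iqx _]].
  by rewrite (open_disjoint_itv_bigcup oU); exists q.
Unshelve. all: by end_near. Qed.

(** The Stieltjes measure restricted to ]a, b] is finite and dominated by Lebesgue measure; the
    density is the Radon-Nikodym derivative. *)
Lemma monotone_abs_continuous_density : exists f : R -> R,
  [/\ forall x, 0 <= f x, mu.-integrable setT (EFin \o f) &
    forall x, a <= x -> x <= b ->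
      (\int[mu]_(t in `]a, x]) (f t)%:E = (G x - G a)%:E)%E].
Proof.
have mD : measurable (`]a, b]%classic : set (measurableTypeR R)) by exact: measurable_itv.
have Dfin : (muG `]a, b]%classic < +oo)%E by rewrite muG_oc// ltry.
pose nu : {finite_measure set _ -> \bar R} := mfrestr mD Dfin.
have numu : nu `<< mu.
  by apply/null_content_dominatesP => A mA A0; rewrite /nu/= /mfrestr/mrestr muG_dominated.
have [f [f0 ffin fint fE]] := radon_nikodym_sigma_finite numu.
have ff : EFin \o (fine \o f) = f by apply/funext => x /=; rewrite fineK.
exists (fine \o f); split.
- by move=> x; exact: fine_ge0.
- by rewrite ff.
- move=> x ax xb; rewrite -muG_oc//.
  transitivity (nu `]a, x]%classic).
    rewrite fE; last exact: measurable_itv.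
    by apply: eq_integral => t _; rewrite /= fineK.
  rewrite /nu/= /mfrestr/mrestr; congr (muG _).
  rewrite setIidl//; exact: subset_itvl.
Qed.

End monotone.

(** * The fundamental theorem of calculus for absolutely continuous functions *)

Lemma abs_continuous_eq (R : realType) (a b : R) (f g : R -> R) :
  (forall x, a <= x -> x <= b -> f x = g x) ->
  abs_continuous_on a b f -> abs_continuous_on a b g.
Proof.
move=> fg acf e e0; have [d d0 H] := acf _ e0; exists d => // n u v uv tuv suv.
rewrite (eq_bigr (fun i => `|f (v i) - f (u i)|)); first exact: H.
by move=> i _; have [au [uiv vb]] := uv i; rewrite !fg// ?(le_trans au)// (le_trans uiv).
Qed.

Lemma abs_continuousB (R : realType) (a b : R) (f g : R -> R) :
  abs_continuous_on a b f -> abs_continuous_on a b g ->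
  abs_continuous_on a b (f \- g).
Proof.
move=> acf acg e e0; have e20 : 0 < e / 2 by rewrite divr_gt0.
have [d1 d10 H1] := acf _ e20; have [d2 d20 H2] := acg _ e20.
exists (Num.min d1 d2); first by rewrite lt_min d10.
move=> n u v uv tuv; rewrite lt_min => /andP[s1 s2].
apply: (@le_lt_trans _ _ (\sum_(i < n) (`|f (v i) - f (u i)| + `|g (v i) - g (u i)|))).
  apply: ler_sum => i _ /=.
  have -> : f (v i) - g (v i) - (f (u i) - g (u i)) =
    (f (v i) - f (u i)) - (g (v i) - g (u i)) by ring.
  exact: ler_normB.
by rewrite big_split/= [ltRHS](splitr e) ltrD ?H1 ?H2.
Qed.

Section ftc.
Variables (R : realType) (a b : R) (F : R -> R).
Hypotheses (ab : a <= b) (acF : abs_continuous_on a b F).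
Let mu : measure _ _ := @lebesgue_measure R.

Let c : R -> R := clamp a b.
(** Jordan decomposition: on [a, b], [F] is [P - N] with both terms nondecreasing and absolutely
    continuous. *)
Let P x := fine (total_variation a (c x) F).
Let N x := P x - F (c x).

Lemma abs_continuous_density : exists2 f : R -> R,
  mu.-integrable setT (EFin \o f) &
    forall x, a <= x -> x <= b -> \int[mu]_(t in `]a, x]) f t = F x - F a.
Proof.
have PB x y : x <= y -> P y - P x = fine (total_variation (c x) (c y) F).
  move=> xy; rewrite /P (total_variation_fineB acF (clamp_ge a b x)) ?clamp_le//.
  exact: clamp_homo.
have ndP : nondecreasing P.
  move=> x y xy; rewrite -subr_ge0 PB// fine_ge0//.
  by apply: total_variation_ge0; exact: clamp_homo.
have ndN : nondecreasing N.
  move=> x y xy; rewrite -subr_ge0.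
  have -> : N y - N x = (P y - P x) - (F (c y) - F (c x)) by rewrite /N; ring.
  rewrite PB// subr_ge0 -lee_fin fineK; last first.
    apply: (total_variation_fin acF); [exact: clamp_ge|exact: clamp_homo|].
    exact: clamp_le.
  apply: le_trans (total_variation_ge F (clamp_homo a b xy)).
  by rewrite lee_fin ler_norm.
have acP : abs_continuous_on a b P.
  apply: (abs_continuous_eq _ (total_variation_abs_continuous acF)) => x ax xb.
  by rewrite /P /c clamp_id.
have acN : abs_continuous_on a b N.
  apply: (abs_continuous_eq _ (abs_continuousB acP acF)) => x ax xb.
  by rewrite /N/= /c clamp_id.
have c_left x : x <= a -> c x = c a by move=> xa; rewrite /c !clamp_left.
have c_right x : b <= x -> c x = c b by move=> bx; rewrite /c !clamp_right.
have [p [_ ip pE]] := monotone_abs_continuous_density ab ndP acP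
  (fun x h => congr1 (fun z => fine (total_variation a z F)) (c_left x h))
  (fun x h => congr1 (fun z => fine (total_variation a z F)) (c_right x h)).
have [q [_ iq qE]] := monotone_abs_continuous_density ab ndN acN
  (fun x h => congr1 (fun z => fine (total_variation a z F) - F z) (c_left x h))
  (fun x h => congr1 (fun z => fine (total_variation a z F) - F z) (c_right x h)).
have pq : EFin \o (p \- q) = ((EFin \o p) \- (EFin \o q))%E by apply/funext.
exists (p \- q); first by rewrite pq; exact: integrableB.
move=> x ax xb; rewrite /Rintegral.
have mI : measurable (`]a, x]%classic : set (measurableTypeR R)) by exact: measurable_itv.
under eq_integral do rewrite EFinB.
rewrite integralB_EFin//; last 2 first.
- by apply: integrableS ip.
- by apply: integrableS iq.
by rewrite pE// qE//= /N /c !clamp_id//; ring.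
Qed.

(** The density is integrable on the whole line, so Lebesgue differentiation applies to its integral
    from -oo, from which [F] differs by a constant near every interior point. Beyond the endpoints
    [F] is arbitrary, hence the strict inequalities. *)
Lemma abs_continuous_FTC : exists f : R -> R,
  [/\ mu.-integrable setT (EFin \o f),
    forall x y, a <= x -> x <= y -> y <= b ->
      \int[mu]_(t in `]x, y]) f t = F y - F x &
    {ae mu, forall x, a < x -> x < b -> is_derive x 1 F (f x)}].
Proof.
have [f intf fE] := abs_continuous_density.
have intfS (D : set (measurableTypeR R)) : measurable D -> mu.-integrable D (EFin \o f).
  by move=> mD; apply: integrableS intf.
exists f; split => //.
  move=> x y ax xy yb; rewrite -(@Rintegral_itvB _ _ (BRight a)).
  - by rewrite fE ?(le_trans ax)// fE ?(le_trans xy)//; ring.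
  - by apply: intfS; exact: measurable_itv.
  - by rewrite bnd_simp.
  - by rewrite bnd_simp.
have := @FTC1Ny R f (fun y => intfS _ (measurable_itv _))
  (open_integrable_locally openT intf).
apply: filterS; first exact: (ae_filter_ringOfSetsType mu).
move=> x [dF F'] ax xb.
set F0 := fun x : R => \int[lebesgue_measure]_(t in `]-oo, x]) f t in dF F'.
have F0E : is_derive x 1 (F0 + cst (F a - F0 a)) (f x).
  apply: is_derive_eq; last exact: addr0.
  apply: is_deriveD; apply: DeriveDef => //; by rewrite -derive1E.
apply: near_eq_is_derive F0E.
near=> y.
have ay : a <= y by apply/ltW; near: y; exact: lt_nbhsr.
have yb : y <= b by apply/ltW; near: y; exact: lt_nbhsl.
have : \int[mu]_(t in `]a, y]) f t = F y - F a by exact: fE.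
rewrite -(@Rintegral_itvB _ _ -oo%O); last 3 first.
- by apply: intfS; exact: measurable_itv.
- by [].
- by rewrite bnd_simp.
by change (F0 y - F0 a = F y - F a -> F0 y + (F a - F0 a) = F y) => h; rewrite addrCA h; ring.
Unshelve. all: by end_near. Qed.

End ftc.

(** * Convexity of powers and one-sided derivatives *)

Lemma powR_mulr_subr1 (R : realType) (alpha r : R) :
  0 < r -> r `^ alpha = r * r `^ (alpha - 1).
Proof.
move=> r0; rewrite -{2}(powRr1 (ltW r0)) -powRD; last by rewrite (gt_eqF r0) implybT.
by congr (_ `^ _); ring.
Qed.

(* Combine [r^(alpha - 1) >= 1 + (alpha - 1) ln r] with [ln r >= 1 - 1 / r]. *)
Lemma powR_bernoulli_lt (R : realType) (alpha r : R) :
  1 < alpha -> 0 < r -> r != 1 -> 1 + alpha * (r - 1) < r `^ alpha.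
Proof.
move=> a1 r0 r1; have l0 : ln r != 0 by rewrite ln_eq0.
have h1 : 1 - ln r < r^-1.
  by rewrite -[in ltRHS](lnK r0) -expRN expR_gt1Dx// oppr_eq0.
have h2 : 1 + (alpha - 1) * ln r < r `^ (alpha - 1).
  by rewrite /powR gt_eqF// expR_gt1Dx// mulf_neq0// subr_eq0 gt_eqF.
rewrite (powR_mulr_subr1 _ r0).
have h3 : r * (1 - ln r) < 1 by rewrite -[ltRHS](mulfV (lt0r_neq0 r0)) ltr_pM2l.
apply: (@le_lt_trans _ _ (r * (1 + (alpha - 1) * ln r))); last by rewrite ltr_pM2l.
nra.
Qed.

(** Bernoulli's inequality at [u / c], scaled by c^alpha; it needs both numbers positive, so [c = 0]
    and [u = 0] are treated apart. *)
Lemma powR_tangent_lt (R : realType) (alpha c u : R) :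
  1 < alpha -> 0 <= c -> 0 <= u -> u != c ->
  c `^ alpha + alpha * c `^ (alpha - 1) * (u - c) < u `^ alpha.
Proof.
move=> a1; have a0 : 0 < alpha by exact: lt_trans a1.
rewrite le_eqVlt => /predU1P[<-|c0].
  rewrite le_eqVlt => /predU1P[<-|u0 _]; first by rewrite eqxx.
  by rewrite !powR0 ?gt_eqF ?subr_gt0// mulr0 mul0r addr0 powR_gt0.
have cE := powR_mulr_subr1 alpha c0.
have p0 : 0 < c `^ (alpha - 1) by rewrite powR_gt0.
rewrite le_eqVlt => /predU1P[<- _|u0 uc].
  by rewrite powR0 ?gt_eqF// cE; have := mulr_gt0 c0 p0; nra.
have r1 : u / c != 1.
  rewrite -subr_eq0 -(mulfV (lt0r_neq0 c0)) -mulrBl.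
  by rewrite mulf_neq0 ?subr_eq0// invr_neq0// gt_eqF.
have := powR_bernoulli_lt a1 (divr_gt0 u0 c0) r1.
have -> : (u / c) `^ alpha = u `^ alpha / c `^ alpha.
  by rewrite powRM ?invr_ge0 ?ltW// -powR_inv1 ?ltW// -powRrM mulN1r powRN.
rewrite ltr_pdivlMr ?powR_gt0//; apply: le_lt_trans.
rewrite le_eqVlt; apply/orP; left; apply/eqP; rewrite cE; field.
by rewrite gt_eqF.
Qed.

Lemma powR_tangent (R : realType) (alpha c u : R) :
  1 < alpha -> 0 <= c -> 0 <= u ->
  c `^ alpha + alpha * c `^ (alpha - 1) * (u - c) <= u `^ alpha.
Proof.
move=> a1 c0 u0; have [->|uc] := eqVneq u c; first by rewrite subrr mulr0 addr0.
exact/ltW/powR_tangent_lt.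
Qed.

Lemma is_derive_has_derivative_on (R : realType) (a b x d : R) (f : R -> R) :
  is_derive x 1 f d -> has_derivative_on a b f x d.
Proof.
move=> [df dE]; rewrite /has_derivative_on; apply: cvg_within_filter.
have dfl : h^-1 *: (f (h *: 1 + x) - f x) @[h --> 0^'] --> d.
  move/cvg_ex : df => [l dfl]; rewrite -dE /derive.
  by have -> := cvg_lim (@Rhausdorff R) dfl.
apply/cvgrPdist_lt => e e0; move/cvgrPdist_lt : dfl => /(_ _ e0).
rewrite !near_withinE => /nbhs_ballP[r /= r0 H].
apply/nbhs_ballP; exists r => // s /= xs sx.
have := H (s - x); rewrite /ball/= sub0r normrN distrC => /(_ xs).
rewrite subr_eq0 => /(_ sx); rewrite [(s - x) *: 1]mulr1 subrK.
by rewrite [_ *: _]mulrC.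
Qed.

(** Passing to the right-hand limit makes the derivative unique even at [x = a], where nothing lies
    on the left. *)
Lemma has_derivative_on_right (R : realType) (a b x d : R) (f : R -> R) :
  a <= x -> x < b -> has_derivative_on a b f x d ->
  (f s - f x) / (s - x) @[s --> x^'+] --> d.
Proof.
move=> ax xb /cvgrPdist_lt H; apply/cvgrPdist_lt => e /H.
rewrite /at_right !near_withinE => H1.
near=> s => xs; apply: (near H1 s _).
- by [].
- by rewrite gt_eqF.
- rewrite /= in_itv/= (le_trans ax (ltW xs))/=; apply/ltW.
  by near: s; exact: lt_nbhsl.
Unshelve. all: by end_near. Qed.

Lemma has_derivative_on_unique (R : realType) (a b x d d' : R) (f : R -> R) :
  a <= x -> x < b -> has_derivative_on a b f x d -> has_derivative_on a b f x d' ->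
  d = d'.
Proof.
move=> ax xb /(has_derivative_on_right ax xb) h /(has_derivative_on_right ax xb) h'.
exact: (cvg_unique _ h h').
Qed.

Lemma has_derivative_on_interior (R : realType) (a b x d : R) (f : R -> R) :
  a < x -> x < b -> has_derivative_on a b f x d -> is_derive x 1 f d.
Proof.
move=> ax xb fd.
have dfl : h^-1 *: (f (h *: 1 + x) - f x) @[h --> 0^'] --> d.
  apply/cvgrPdist_lt => e e0; move/cvgrPdist_lt : fd => /(_ _ e0).
  rewrite !near_withinE => /nbhs_ballP[r /= r0 H].
  apply/nbhs_ballP; exists (Num.min r (Num.min (x - a) (b - x))) => /=.
    by rewrite !lt_min r0 !subr_gt0 ax.
  move=> h; rewrite /ball/= sub0r normrN !lt_min => /and3P[hr ha hb] h0.
  have /andP[{}ha _] : - (x - a) < h < x - a by rewrite -ltr_norml.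
  have /andP[_ {}hb] : - (b - x) < h < b - x by rewrite -ltr_norml.
  have := H (h + x); rewrite /ball/= opprD addrCA subrr addr0 normrN => /(_ hr).
  rewrite -subr_eq0 addrK => /(_ h0); rewrite in_itv/= [h *: 1]mulr1.
  have -> : h^-1 *: (f (h + x) - f x) = (f (h + x) - f x) / h by exact: mulrC.
  by apply; apply/andP; split; lra.
apply: DeriveDef; first by apply/cvg_ex; exists d.
exact: (cvg_lim (@Rhausdorff R) dfl).
Qed.

Lemma has_derivative_on_eq (R : realType) (a b x c d : R) (f g : R -> R) :
  x < c -> (forall s, a <= s -> s < c -> f s = g s) -> a <= x ->
  has_derivative_on a b f x d -> has_derivative_on a b g x d.
Proof.
move=> xc fg ax /cvgrPdist_lt H; apply/cvgrPdist_lt => e /H.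
rewrite !near_withinE => H1.
near=> s => sx sab.
have sc : s < c by near: s; exact: lt_nbhsl.
have as_ : a <= s by move: sab; rewrite /= in_itv/= => /andP[].
by rewrite -!fg//; apply: (near H1 s _).
Unshelve. all: by end_near. Qed.

(* The running cost of a plan is only equal almost everywhere to a Borel function,
   so the library's monotonicity lemmas do not apply to it. *)
Lemma ge0_le_integral_nonmeasurable d (T : measurableType d) (R : realType)
    (mu : {measure set T -> \bar R}) (D E : set T) (f g : T -> \bar R) :
  E `<=` D -> (forall x, D x -> 0 <= f x)%E -> (forall x, E x -> 0 <= g x)%E ->
  (forall x, E x -> g x <= f x)%E ->
  (\int[mu]_(x in E) g x <= \int[mu]_(x in D) f x)%E.
Proof.
move=> ED f0 g0 gf.
have H (h : T -> \bar R) : (forall x, 0 <= h x)%E -> (h^\-)%E = cst 0%E.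
  by move=> h0; apply/funext => x; rewrite funenegE; apply/max_idPr; rewrite leeNl oppe0.
rewrite /integral /= !H; last 2 first.
- by move=> x; rewrite patchE; case: ifPn => // /[!inE]; exact: f0.
- by move=> x; rewrite patchE; case: ifPn => // /[!inE]; exact: g0.
apply: leeD2r.
apply: le_ereal_sup => _ [h hg <-]; exists h => // x; apply: le_trans (hg x) _.
rewrite !funeposE !patchE; case: ifPn => [/[!inE] Ex|_].
  have Dx : x \in D by rewrite inE; exact: ED.
  by rewrite Dx le_max2// gf.
by rewrite maxxx le_max lexx orbT.
Qed.

(** * Optimal plans *)

Lemma is_derive_continuous (R : realType) (f : R -> R) (x d : R) :
  is_derive x 1 f d -> {for x, continuous f}.
Proof.
by move=> [df _]; apply: differentiable_continuous; exact/derivable1_diffP.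
Qed.

Lemma is_derive_within_continuous (R : realType) (f g : R -> R) (a b : R) :
  (forall x, a <= x -> x <= b -> is_derive x 1 f (g x)) ->
  {within `[a, b], continuous f}.
Proof.
move=> H; apply: derivable_within_continuous => x; rewrite in_itv/= => /andP[ax xb].
by have [] := H x ax xb.
Qed.

Lemma lipschitz_abs_continuous (R : realType) (a b L : R) (f : R -> R) :
  0 < L -> (forall x y, a <= x -> x <= y -> y <= b -> `|f y - f x| <= L * (y - x)) ->
  abs_continuous_on a b f.
Proof.
move=> L0 H e e0; exists (e / L); first by rewrite divr_gt0.
move=> n u v uv _; rewrite ltr_pdivlMr// mulrC mulr_sumr; apply: le_lt_trans.
by apply: ler_sum => i _; have [? [? ?]] := uv i; exact: H.
Qed.

Lemma measurable_effort_cost (R : realType) (alpha : R) :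
  measurable_fun setT (effort_cost alpha : R -> \bar R).
Proof.
apply: measurable_fun_ifT => //.
- by apply: measurable_fun_ler; [exact: measurable_cst|exact: measurable_id].
- by apply/measurable_EFinP; exact: measurable_powR.
Qed.

Lemma effort_cost_ge0 (R : realType) (alpha v : R) : (0 <= effort_cost alpha v)%E.
Proof. by rewrite /effort_cost; case: ifPn => // _; rewrite lee_fin powR_ge0. Qed.

(** Here [g] may change sign and [f] may have infinite integral; the comparison goes through the
    positive part of [g]. *)
Lemma integral_le_ge0 d (T : measurableType d) (R : realType)
    (mu : {measure set T -> \bar R}) (D : set T) (g f : T -> \bar R) :
  measurable D -> mu.-integrable D g -> measurable_fun D f ->
  (forall x, D x -> 0 <= f x)%E -> (forall x, D x -> g x <= f x)%E ->
  (\int[mu]_(x in D) g x <= \int[mu]_(x in D) f x)%E.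
Proof.
move=> mD intg mf f0 gf; rewrite [leLHS]integralE.
apply: (@le_trans _ _ (\int[mu]_(x in D) g^\+ x)%E).
  rewrite -[leRHS]sube0; apply: leeB => //.
  by apply: integral_ge0 => *; exact: funeneg_ge0.
apply: ge0_le_integral => //.
  by apply: measurable_funepos; have /integrableP[] := intg.
by move=> x Dx; rewrite funeposE ge_max gf// f0.
Qed.

(* [w] is [gamma t ^ (-1 / (alpha - 1))], the shape of the optimal speed, and [W] its
   primitive. *)
Section planning.
Variables (R : realType) (t T theta reward alpha : R) (gamma : R -> R -> R) (w W : R -> R).
Hypotheses (tT : t < T) (a1 : 1 < alpha).
Hypothesis w_gt0 : forall s, t <= s -> s <= T -> 0 < w s.
Hypothesis gamma_gt0 : forall s, t <= s -> s <= T -> 0 < gamma t s.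
Hypothesis gammaw : forall s, t <= s -> s <= T -> gamma t s * w s `^ (alpha - 1) = 1.
Hypothesis dW : forall s, t <= s -> s <= T -> is_derive s 1 W (w s).
Hypothesis mgamma : measurable_fun setT (gamma t).
Hypothesis cw : {within `[t, T], continuous w}.
Hypothesis Wt : W t = 0.
Let mu : measure _ _ := @lebesgue_measure R.

Let a0 : 0 < alpha. Proof. exact: lt_trans a1. Qed.

Definition effort_on_plan (y : R -> R) : \bar R :=
  (\int[lebesgue_measure]_(s in `[t, T])
    ((gamma t s)%:E * effort_cost alpha (derive1 y s)))%E.

Let Wlt u v : t <= u -> u < v -> v <= T -> W u < W v.
Proof.
move=> tu uv vT.
have [| |c] := @MVT_segment R W w u v (ltW uv).
- move=> s; rewrite in_itv/= => /andP[us sv].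
  by apply: dW; [exact: le_trans (ltW us)|exact: le_trans (ltW sv) _].
- apply: (@is_derive_within_continuous _ _ w) => s us sv.
  by apply: dW; [exact: le_trans us|exact: le_trans sv _].
rewrite in_itv/= => /andP[uc cv] E; rewrite -subr_gt0 E mulr_gt0 ?subr_gt0//.
by apply: w_gt0; [exact: le_trans uc|exact: le_trans cv _].
Qed.

Let w_lip : exists2 L, 0 < L & forall u v, t <= u -> u <= v -> v <= T ->
  `|W v - W u| <= L * (v - u).
Proof.
have [c + cmax] := EVT_max (ltW tT) cw; rewrite in_itv/= => /andP[tc cT].
exists (w c); first exact: w_gt0.
move=> u v tu uv vT.
have [s|  |s] := @MVT_segment R W w u v uv.
- rewrite in_itv/= => /andP[us sv].
  by apply: dW; [exact: le_trans (ltW us)|exact: le_trans (ltW sv) _].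
- apply: (@is_derive_within_continuous _ _ w) => s us sv.
  by apply: dW; [exact: le_trans us|exact: le_trans sv _].
rewrite in_itv/= => /andP[us sv] ->; rewrite normrM ger0_norm; last first.
  by apply/ltW/w_gt0; [exact: le_trans us|exact: le_trans sv _].
rewrite ger0_norm ?subr_ge0// ler_wpM2r ?subr_ge0// cmax// in_itv/=.
by rewrite (le_trans tu us) (le_trans sv vT).
Qed.

Let w_integrable u v : t <= u -> v <= T ->
  mu.-integrable `]u, v] (EFin \o w).
Proof.
move=> tu vT.
have iw : mu.-integrable `[t, T] (EFin \o w).
  by apply: continuous_compact_integrable => //; exact: segment_compact.
apply: integrableS iw; [exact: measurable_itv|exact: measurable_itv|].
by move=> s; rewrite /= !in_itv/= => /andP[us sv]; rewrite (le_trans tu (ltW us)) (le_trans sv).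
Qed.

Let Rintegral_w u v : t <= u -> u <= v -> v <= T ->
  \int[mu]_(s in `]u, v]) w s = W v - W u.
Proof.
move=> tu; rewrite le_eqVlt => /predU1P[<-|uv] vT.
  by rewrite subrr set_itvoc0// Rintegral_set0.
rewrite Rintegral_itv_obnd_cbnd; last exact: w_integrable.
rewrite /Rintegral (@continuous_FTC2 _ w W)//.
- apply: continuous_subspaceW cw => s; rewrite /= !in_itv/= => /andP[us sv].
  by rewrite (le_trans tu us) (le_trans sv vT).
- split.
  + move=> s; rewrite in_itv/= => /andP[us sv].
    by have [] := dW (le_trans tu (ltW us)) (le_trans (ltW sv) vT).
  + apply: cvg_at_right_filter; apply: is_derive_continuous (dW tu _).
    exact/ltW/(lt_le_trans uv).
  + apply: cvg_at_left_filter; apply: is_derive_continuous (dW _ vT).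
    exact/ltW/(le_lt_trans tu).
- move=> s; rewrite in_itv/= => /andP[us sv].
  have [dWs <-] := dW (le_trans tu (ltW us)) (le_trans (ltW sv) vT).
  by rewrite derive1E.
Qed.

(* An affine lower bound of the running cost as a function of the speed [v]. Along a
   plan [y] the integral of [p * y' - r * w] depends only on the end values of [y]. *)
Definition supporting_line (p r : R) := forall s v, t <= s -> s <= T ->
  ((p * v - r * w s)%:E <= (gamma t s)%:E * effort_cost alpha v)%E.

Lemma supporting_line_tangent (C : R) : 0 <= C ->
  supporting_line (alpha * C `^ (alpha - 1)) ((alpha - 1) * C `^ alpha).
Proof.
move=> C0 s v ts sT; rewrite /effort_cost; case: ifPn => v0; last first.
  by rewrite gt0_muley ?lte_fin ?gamma_gt0// leey.
rewrite -EFinM lee_fin.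
have w0 := w_gt0 ts sT; have g0 := gamma_gt0 ts sT; have gw := gammaw ts sT.
have Cw0 : 0 <= C * w s by rewrite mulr_ge0// ltW.
apply: le_trans (ler_wpM2l (ltW g0) (powR_tangent a1 Cw0 v0)).
rewrite !powRM// ?(ltW w0)// (powR_mulr_subr1 alpha w0).
have CE : C * C `^ (alpha - 1) = C `^ alpha.
  move: C0; rewrite le_eqVlt => /predU1P[<-|C0]; last by rewrite -powR_mulr_subr1.
  by rewrite mul0r powR0// gt_eqF.
rewrite -CE le_eqVlt; apply/orP; left; apply/eqP.
set g := gamma t s in gw *; set o := w s `^ _ in gw *.
(* The factor [g * o] is 1; inserting it in both terms leaves a polynomial identity. *)
transitivity (alpha * C `^ (alpha - 1) * v * (g * o) -
  (alpha - 1) * (C * C `^ (alpha - 1)) * w s * (g * o)).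
  by rewrite gw !mulr1.
ring.
Qed.

(** Negative speeds cost +oo, so a line of arbitrarily steep negative slope stays below the cost.
    This is what forces plans of finite effort to be nondecreasing. *)
Lemma supporting_line_neg (M : R) : 0 <= M -> supporting_line (- M) 0.
Proof.
move=> M0 s v ts sT; rewrite mul0r subr0 /effort_cost; case: ifPn => v0; last first.
  by rewrite gt0_muley ?lte_fin ?gamma_gt0// leey.
rewrite -EFinM lee_fin mulNr; apply: (@le_trans _ _ 0); first by rewrite oppr_le0 mulr_ge0.
by rewrite mulr_ge0 ?powR_ge0// ltW// gamma_gt0.
Qed.

Lemma supporting_line0 : supporting_line 0 0.
Proof. by move=> s v ts sT; have := supporting_line_neg (lexx 0) v ts sT; rewrite oppr0. Qed.

Let integral_line (p r u v : R) (f : R -> R) (y : R -> R) :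
  t <= u -> u <= v -> v <= T ->
  mu.-integrable setT (EFin \o f) ->
  \int[mu]_(s in `]u, v]) f s = y v - y u ->
  (\int[mu]_(s in `]u, v]) (p * f s - r * w s)%:E)%E = (p * (y v - y u) - r * (W v - W u))%:E /\
  mu.-integrable `]u, v] (EFin \o (fun s => p * f s - r * w s)).
Proof.
move=> tu uv vT intf fE.
have mD : measurable (`]u, v]%classic : set (measurableTypeR R)) by exact: measurable_itv.
have i1 : mu.-integrable `]u, v] (EFin \o f) by apply: integrableS intf.
have i2 := w_integrable tu vT.
have i1p : mu.-integrable `]u, v] (EFin \o (fun s => p * f s)).
  by apply: eq_integrable (integrableZl mD p i1) => // s _; rewrite /= EFinM.
have i2r : mu.-integrable `]u, v] (EFin \o (fun s => r * w s)).
  by apply: eq_integrable (integrableZl mD r i2) => // s _; rewrite /= EFinM.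
have i3 : mu.-integrable `]u, v] (EFin \o (fun s => p * f s - r * w s)).
  by apply: eq_integrable (integrableB mD i1p i2r) => // s _; rewrite /= EFinB.
split => //.
rewrite -[LHS]fineK; last exact: integrable_fin_num.
congr EFin; rewrite -/(Rintegral _ _ _) RintegralB// !RintegralZl//.
by rewrite fE Rintegral_w.
Qed.

(** Two independent lines, before and after [s], make the bound depend on the intermediate value
    [y s]; with a single line only the end values would enter. *)
Lemma effort_on_plan_lower (y : R -> R) (s p1 r1 p2 r2 : R) :
  abs_continuous_on t T y -> t <= s -> s <= T ->
  supporting_line p1 r1 -> supporting_line p2 r2 ->
  ((p1 * (y s - y t) - r1 * (W s - W t) +
    (p2 * (y T - y s) - r2 * (W T - W s)))%:E <= effort_on_plan y)%E.
Proof.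
move=> acy ts sT line1 line2.
have [f [intf fE [N [mN N0 Nsub]]]] := abs_continuous_FTC (ltW tT) acy.
(* The running cost with the density in place of [derive1 y], which makes it measurable. *)
pose F s := ((gamma t s)%:E * effort_cost alpha (f s))%E.
have mf : measurable_fun setT f by apply/measurable_EFinP; have /integrableP[] := intf.
have mF : measurable_fun setT F.
  apply: emeasurable_funM; first by apply/measurable_EFinP; exact: mgamma.
  by apply: measurableT_comp mf; exact: measurable_effort_cost.
have mT : measurable ([set T] : set (measurableTypeR R)) by exact: measurable_set1.
(* The density is known to be the derivative only at interior points, so [T] joins the null set; [t]
   is already left out by the half-open intervals. *)
pose N' := N `|` [set T].
have mN' : measurable (N' : set (measurableTypeR R)) by exact: measurableU.
have N'0 : mu N' = 0%E.
  apply/eqP; rewrite eq_le measure_ge0 andbT.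
  apply: le_trans (measureU2 _ mN mT) _.
  rewrite [X in (X + _)%E](_ : _ = 0%E); last exact: N0.
  by rewrite add0e le_eqVlt; apply/orP; left; apply/eqP; exact: lebesgue_measure_set1.
have piece p r u v : supporting_line p r -> t <= u -> u <= v -> v <= T ->
    ((p * (y v - y u) - r * (W v - W u))%:E <= \int[mu]_(s in `]u, v] `\` N') F s)%E.
  move=> line tu uv vT.
  have [<- iL] := integral_line p r tu uv vT intf (fE _ _ tu uv vT).
  have mD : measurable (`]u, v]%classic : set (measurableTypeR R)) by exact: measurable_itv.
  have mDN : measurable (`]u, v]%classic `\` N' : set (measurableTypeR R)) by exact: measurableD.
  rewrite (negligible_integral mN' mD iL N'0).
  apply: integral_le_ge0 => //.
  - by apply: integrableS iL => //; exact: subDsetl.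
  - exact: measurable_funTS.
  - move=> c [/=]; rewrite in_itv/= => /andP[uc cv] _.
    have tc : t <= c := le_trans tu (ltW uc); have cT : c <= T := le_trans cv vT.
    by rewrite mule_ge0 ?effort_cost_ge0// lee_fin ltW//; exact: gamma_gt0.
  - move=> c [/=]; rewrite in_itv/= => /andP[uc cv] _.
    have tc : t <= c := le_trans tu (ltW uc); have cT : c <= T := le_trans cv vT.
    exact: line.
rewrite EFinD; apply: le_trans (leeD (piece _ _ _ _ line1 (lexx t) ts sT)
  (piece _ _ _ _ line2 ts sT (lexx T))) _.
have F0 c : t <= c -> c <= T -> (0 <= F c)%E.
  by move=> tc cT; rewrite mule_ge0 ?effort_cost_ge0// lee_fin ltW//; exact: gamma_gt0.
rewrite -ge0_integral_setU; last 5 first.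
- by apply: measurableD => //; exact: measurable_itv.
- by apply: measurableD => //; exact: measurable_itv.
- by apply: measurable_funTS.
- move=> c [[]|[]] /=; rewrite in_itv/= => /andP[h1 h2] _; apply: F0.
  + exact: ltW.
  + exact: le_trans sT.
  + exact/ltW/(le_lt_trans ts).
  + by [].
- apply/disj_set2P; rewrite -subset0 => c [[/= + _] [/= + _]]; rewrite !in_itv/=.
  by move=> /andP[_ h1] /andP[h2 _]; move: (lt_le_trans h2 h1); rewrite ltxx.
have inD c : ((`]t, s] `\` N') `|` (`]s, T] `\` N'))%classic c -> [/\ t < c, c < T & ~ N c].
  have aux : c <= T -> ~ N' c -> c < T /\ ~ N c.
    move=> cT cN; split; last by move=> Nc; apply: cN; left.
    by rewrite lt_neqAle cT andbT; apply/eqP => cE; apply: cN; right.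
  case=> -[/=]; rewrite in_itv/= => /andP[h1 h2] cN.
    by have [] := aux (le_trans h2 sT) cN.
  by have [] := aux h2 cN; split => //; exact: le_lt_trans h1.
(* Return from [F] to the actual running cost: they agree off the null set, and the cost is
   nonnegative on the rest of [t, T]. *)
apply: ge0_le_integral_nonmeasurable.
- by move=> c /inD[tc cT _]; rewrite /= in_itv/= !ltW.
- move=> c; rewrite /= in_itv/= => /andP[tc cT].
  by rewrite mule_ge0 ?effort_cost_ge0// lee_fin ltW//; exact: gamma_gt0.
- by move=> c /inD[tc cT _]; apply: F0; exact: ltW.
- move=> c /inD[tc cT cN]; rewrite /F.
  have [_ <-] : is_derive c 1 y (f c).
    by apply: contrapT => h; apply: cN; apply: Nsub => /= /(_ tc cT).
  by rewrite derive1E.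
Qed.

(** * Minimizers at a state below the goal *)

Variable x : R.
Hypothesis hx : x < theta.

(** The candidates for the minimum are [path 0], which rests, and [path C], which reaches [theta]
    exactly at [T]. *)
Let path (c s : R) : R := x + c * W s.

Let WT_gt0 : 0 < W T. Proof. by rewrite -[ltLHS]Wt; exact: Wlt. Qed.

Let path_derive c s : t <= s -> s <= T -> is_derive s 1 (path c) (c * w s).
Proof.
move=> ts sT; have dWs := dW ts sT.
have h : is_derive s 1 (cst x + (c *: (W : R -> R^o))) (0 + c *: w s).
  by apply: is_deriveD; exact: is_deriveZ.
by move: h; rewrite add0r.
Qed.

Let path_plan c : 0 <= c -> plan T t x (path c).
Proof.
move=> c0; split; last by rewrite /path Wt mulr0 addr0.
have [L L0 H] := w_lip.
apply: (@lipschitz_abs_continuous _ _ _ ((c + 1) * L)); first by rewrite mulr_gt0// ltr_wpDl.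
move=> u v tu uv vT.
have -> : path c v - path c u = c * (W v - W u) by rewrite /path; ring.
rewrite normrM (ger0_norm c0) -mulrA.
by apply: ler_pM => //; [rewrite lerDl|exact: H].
Qed.

Let effort_path c : 0 <= c -> effort_on_plan (path c) = (c `^ alpha * W T)%:E.
Proof.
move=> c0.
have mI : measurable (`[t, T]%classic : set (measurableTypeR R)) by exact: measurable_itv.
have iw : mu.-integrable `[t, T] (EFin \o w).
  by apply: continuous_compact_integrable => //; exact: segment_compact.
have : (\int[mu]_(s in `[t, T]) ((c `^ alpha)%:E * (w s)%:E) = (c `^ alpha * W T)%:E)%E.
  rewrite integralZl// EFinM; congr (_ * _)%E.
  rewrite -[LHS]fineK; last exact: integrable_fin_num.
  congr EFin; rewrite -/(Rintegral _ _ _) -Rintegral_itv_obnd_cbnd; last exact: w_integrable.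
  by rewrite Rintegral_w// ?(ltW tT)// Wt subr0.
move=> <-; apply: eq_integral => s; rewrite inE/= in_itv/= => /andP[ts sT].
rewrite derive1E; have [_ ->] := path_derive c ts sT.
have w0 := w_gt0 ts sT.
rewrite /effort_cost mulr_ge0// ?(ltW w0)// -!EFinM; congr EFin.
rewrite powRM// ?(ltW w0)// (powR_mulr_subr1 alpha w0).
transitivity (c `^ alpha * w s * (gamma t s * w s `^ (alpha - 1))); first by ring.
by rewrite gammaw// mulr1.
Qed.

(** Against a drop of size [q] before or after [s], the line of slope - (|e| + 1) / q gives an
    effort of at least |e| + 1, which exceeds [e]. *)
Let effort_nondecreasing y s e : plan T t x y -> t <= s -> s <= T ->
  (effort_on_plan y <= e%:E)%E -> x <= y s /\ y s <= y T.
Proof.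
move=> [acy yt] ts sT ye; have e0 : 0 <= `|e| + 1 by rewrite addr_ge0.
split; rewrite leNgt; apply/negP => lt_y.
- have M0 : 0 <= (`|e| + 1) / (x - y s) by rewrite divr_ge0 // subr_ge0 ltW.
  have := le_trans (effort_on_plan_lower acy ts sT (supporting_line_neg M0) supporting_line0) ye.
  rewrite !mul0r !subr0 addr0 lee_fin yt mulNr -mulrN opprB mulfVK ?subr_eq0 ?gt_eqF//.
  by apply/negP; rewrite -ltNge (le_lt_trans (ler_norm e))// ltrDl.
- have M0 : 0 <= (`|e| + 1) / (y s - y T) by rewrite divr_ge0 // subr_ge0 ltW.
  have := le_trans (effort_on_plan_lower acy ts sT supporting_line0 (supporting_line_neg M0)) ye.
  rewrite !mul0r !subr0 add0r lee_fin mulNr -mulrN opprB mulfVK ?subr_eq0 ?gt_eqF//.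
  by apply/negP; rewrite -ltNge (le_lt_trans (ler_norm e))// ltrDl.
Qed.

(** For a plan that gains [a] while [W] gains [V], the tangent with ratio [a / V] yields exactly the
    effort of the plan of speed [(a / V) * w]. *)
Let tangent_value (a V : R) : 0 < V -> 0 <= a ->
  alpha * (a / V) `^ (alpha - 1) * a - (alpha - 1) * (a / V) `^ alpha * V = V * (a / V) `^ alpha.
Proof.
move=> V0; rewrite le_eqVlt => /predU1P[<-|a_gt0].
  by rewrite mul0r !powR0 ?gt_eqF ?subr_gt0//; ring.
rewrite (powR_mulr_subr1 alpha (divr_gt0 a_gt0 V0)); field.
by rewrite gt_eqF.
Qed.

(** The left side is the effort of the plan through the same values at [t], [s] and [T] whose speed
    is a multiple of [w] on each piece. *)
Let effort_two_slopes y s : plan T t x y -> t < s -> s < T -> x <= y s -> y s <= y T ->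
  ((W s * ((y s - x) / W s) `^ alpha +
    (W T - W s) * ((y T - y s) / (W T - W s)) `^ alpha)%:E <= effort_on_plan y)%E.
Proof.
move=> [acy yt] ts sT xs sy.
have V1 : 0 < W s by rewrite -[ltLHS]Wt; exact: Wlt (ltW sT).
have V2 : 0 < W T - W s by rewrite subr_gt0; exact: Wlt (ltW ts) sT _.
have a_ge0 : 0 <= y s - x by rewrite subr_ge0.
have b_ge0 : 0 <= y T - y s by rewrite subr_ge0.
have := effort_on_plan_lower acy (ltW ts) (ltW sT)
  (supporting_line_tangent (divr_ge0 a_ge0 (ltW V1)))
  (supporting_line_tangent (divr_ge0 b_ge0 (ltW V2))).
by rewrite yt Wt subr0 !tangent_value.
Qed.

Let C : R := (theta - x) / W T.
Let K : R := C `^ alpha * W T.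

Let C_gt0 : 0 < C. Proof. by rewrite divr_gt0// subr_gt0. Qed.

Let effort_reach y : plan T t x y -> theta <= y T -> (K%:E <= effort_on_plan y)%E.
Proof.
move=> [acy yt] yT.
have := effort_on_plan_lower acy (ltW tT) (lexx T)
  (supporting_line_tangent (ltW C_gt0)) supporting_line0.
apply: le_trans; rewrite lee_fin !mul0r !subr0 addr0 yt Wt subr0.
have x0 : 0 <= theta - x by rewrite subr_ge0 ltW.
(* A plan may overshoot [theta]; as the slope of the line is nonnegative, this only raises the
   bound. *)
rewrite /K mulrC -(tangent_value WT_gt0 x0) lerB// ler_wpM2l ?lerB//.
by rewrite mulr_ge0 ?powR_ge0// ltW.
Qed.

Let perceivedE y : perceived_cost T theta reward alpha gamma t y =
  (effort_on_plan y - (gamma t T * reward * (theta <= y T)%R%:R)%:E)%E.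
Proof. by []. Qed.

Let perceived_path0 : perceived_cost T theta reward alpha gamma t (path 0) = 0%E.
Proof.
by rewrite perceivedE effort_path// powR0 ?gt_eqF// /path !mul0r addr0 leNgt hx/= mulr0 subee.
Qed.

Let perceived_pathC :
  perceived_cost T theta reward alpha gamma t (path C) = (K - gamma t T * reward)%:E.
Proof.
rewrite perceivedE effort_path ?(ltW C_gt0)//.
have -> : path C T = theta by rewrite /path /C mulfVK ?gt_eqF// addrCA subrr addr0.
by rewrite lexx mulr1 EFinB.
Qed.

Let effort_ge0 y : (0 <= effort_on_plan y)%E.
Proof.
apply: integral_ge0 => s; rewrite /= in_itv/= => /andP[ts sT].
by rewrite mule_ge0 ?effort_cost_ge0// lee_fin ltW// gamma_gt0.
Qed.

Let perceived_reach y : theta <= y T -> perceived_cost T theta reward alpha gamma t y =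
  (effort_on_plan y - (gamma t T * reward)%:E)%E.
Proof. by move=> yT; rewrite perceivedE yT mulr1. Qed.

Let perceived_noreach y : y T < theta -> perceived_cost T theta reward alpha gamma t y =
  effort_on_plan y.
Proof. by move=> yT; rewrite perceivedE leNgt yT/= mulr0 sube0. Qed.

Let optimal_pathC : K <= gamma t T * reward ->
  optimal_plan T theta reward alpha gamma t x (path C).
Proof.
move=> KR; split; first exact/path_plan/ltW.
move=> z pz; rewrite perceived_pathC; have [zT|zT] := leP theta (z T).
  by rewrite perceived_reach// EFinB leeB// effort_reach.
by rewrite perceived_noreach//; apply: le_trans (effort_ge0 z); rewrite lee_fin subr_le0.
Qed.

Let optimal_path0 : gamma t T * reward <= K ->
  optimal_plan T theta reward alpha gamma t x (path 0).
Proof.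
move=> KR; split; first exact/path_plan.
move=> z pz; rewrite perceived_path0; have [zT|zT] := leP theta (z T).
  rewrite perceived_reach//; apply: (@le_trans _ _ (K%:E - (gamma t T * reward)%:E)%E).
    by rewrite -EFinB lee_fin subr_ge0.
  by rewrite leeB// effort_reach.
by rewrite perceived_noreach.
Qed.

(** Comparison with [path 0] leaves no effort to spend, while any progress made by a time [s < T]
    would cost a positive amount. Comparison with [path C] gives the inequality. *)
Let optimal_noreach y v : optimal_plan T theta reward alpha gamma t x y ->
  y T < theta -> has_derivative_on t T y t v -> v = 0 /\ gamma t T * reward <= K.
Proof.
move=> [py oy] yT dv; split; last first.
  have := oy _ (path_plan (ltW C_gt0)); rewrite perceived_pathC perceived_noreach//.
  by move=> /(le_trans (effort_ge0 y)); rewrite lee_fin subr_ge0.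
have y0 : (effort_on_plan y <= 0%:E)%E.
  by have := oy _ (path_plan (lexx 0)); rewrite perceived_path0 perceived_noreach.
have yx s : t <= s -> s < T -> y s = path 0 s.
  rewrite /path mul0r addr0 le_eqVlt => /predU1P[<- _|ts sT]; first by case: py.
  have [xs sy] := effort_nondecreasing py (ltW ts) (ltW sT) y0.
  apply/eqP; rewrite eq_le xs andbT leNgt; apply/negP => xys.
  have := le_trans (effort_two_slopes py ts sT xs sy) y0.
  rewrite lee_fin leNgt => /negP; apply.
  have V1 : 0 < W s by rewrite -[ltLHS]Wt; exact: Wlt (ltW sT).
  have V2 : 0 < W T - W s by rewrite subr_gt0; exact: Wlt (ltW ts) sT _.
  rewrite ltr_pwDl// ?mulr_ge0 ?powR_ge0 ?(ltW V2)//.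
  by rewrite mulr_gt0// powR_gt0// divr_gt0// subr_gt0.
have := has_derivative_on_eq tT yx (lexx t) dv.
have := is_derive_has_derivative_on t T (path_derive 0 (lexx t) (ltW tT)).
by rewrite mul0r => h1 h2; rewrite (has_derivative_on_unique (lexx t) tT h2 h1).
Qed.

(** Comparison with [path C] bounds the effort by [K], and the two-slope bound then pins down [y s]
    at every [s < T]. Comparison with [path 0] gives the inequality. *)
Let optimal_reach y v : optimal_plan T theta reward alpha gamma t x y ->
  theta <= y T -> has_derivative_on t T y t v -> v = C * w t /\ K <= gamma t T * reward.
Proof.
move=> [py oy] yT dv; split; last first.
  have := oy _ (path_plan (lexx 0)); rewrite perceived_path0 perceived_reach//.
  rewrite leeBlDr// add0e => /(le_trans (effort_reach py yT)).
  by rewrite lee_fin.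
have yK : (effort_on_plan y <= K%:E)%E.
  have := oy _ (path_plan (ltW C_gt0)); rewrite perceived_pathC perceived_reach//.
  by rewrite EFinB leeD2rE.
have yx s : t <= s -> s < T -> y s = path C s.
  rewrite le_eqVlt => /predU1P[<- _|ts sT].
    by case: py => _ ->; rewrite /path Wt mulr0 addr0.
  have [xs sy] := effort_nondecreasing py (ltW ts) (ltW sT) yK.
  have V1 : 0 < W s by rewrite -[ltLHS]Wt; exact: Wlt (ltW sT).
  have V2 : 0 < W T - W s by rewrite subr_gt0; exact: Wlt (ltW ts) sT _.
  have := le_trans (effort_two_slopes py ts sT xs sy) yK.
  set c1 := (y s - x) / W s; set c2 := (y T - y s) / (W T - W s).
  have c10 : 0 <= c1 by rewrite divr_ge0 ?subr_ge0// ltW.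
  have c20 : 0 <= c2 by apply: divr_ge0; [rewrite subr_ge0|exact: ltW].
  have e1 : y s - x = c1 * W s by rewrite /c1 mulfVK// gt_eqF.
  have e2 : y T - y s = c2 * (W T - W s) by rewrite /c2 mulfVK// gt_eqF.
  have e3 : theta - x = C * W T by rewrite /C mulfVK// gt_eqF.
  have [c1C _|c1C] := eqVneq c1 C; first by rewrite /path -c1C -e1 addrCA subrr addr0.
  rewrite lee_fin leNgt => /negP; case.
  (* Tangents at the same [C] on both pieces, strict on the first: their weighted sum is at least
     [K] since [theta <= y T], so the effort would exceed [K]. *)
  have h1 := powR_tangent_lt a1 (ltW C_gt0) c10 c1C.
  have h2 := powR_tangent a1 (ltW C_gt0) c20.
  rewrite -(ltr_pM2l V1) in h1; rewrite -(ler_pM2l V2) in h2.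
  apply: le_lt_trans (ltr_leD h1 h2).
  have -> : W s * (C `^ alpha + alpha * C `^ (alpha - 1) * (c1 - C)) +
    (W T - W s) * (C `^ alpha + alpha * C `^ (alpha - 1) * (c2 - C)) =
    K + alpha * C `^ (alpha - 1) * ((c1 * W s + c2 * (W T - W s)) - C * W T).
    by rewrite /K; ring.
  rewrite lerDl mulr_ge0//; first by rewrite mulr_ge0 ?powR_ge0// ltW.
  by rewrite -e1 -e2 -e3; lra.
have := has_derivative_on_eq tT yx (lexx t) dv.
have := is_derive_has_derivative_on t T (path_derive C (lexx t) (ltW tT)).
by move=> h1 h2; rewrite (has_derivative_on_unique (lexx t) tT h2 h1).
Qed.

(** In case of equality both candidates are optimal, and the rule of the largest initial derivative
    selects [path C], whose initial speed is positive; hence the non-strict test. *)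
Lemma chosen_speedP v : chosen_speed T theta reward alpha gamma t x v <->
  v = if ((theta - x) / W T) `^ alpha * W T <= gamma t T * reward
      then (theta - x) / W T * w t else 0.
Proof.
rewrite -/C -/K.
have dC := is_derive_has_derivative_on t T (path_derive C (lexx t) (ltW tT)).
have d0 := is_derive_has_derivative_on t T (path_derive 0 (lexx t) (ltW tT)).
rewrite mul0r in d0.
have Cw : 0 < C * w t by rewrite mulr_gt0// w_gt0// ltW.
have alt y w' : optimal_plan T theta reward alpha gamma t x y -> has_derivative_on t T y t w' ->
    (w' = C * w t /\ K <= gamma t T * reward) \/ (w' = 0 /\ gamma t T * reward <= K).
  move=> oy dy; have [yT|yT] := leP theta (y T).
    by left; exact: optimal_reach oy yT dy.
  by right; exact: optimal_noreach oy yT dy.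
case: leP => KR; split.
- move=> [y [oy dy maxy]].
  have [[]//|[v0 _]] := alt _ _ oy dy.
  by move: (maxy _ _ (optimal_pathC KR) dC); rewrite v0 leNgt Cw.
- move=> ->; exists (path C); split => //; first exact: optimal_pathC.
  by move=> z w' oz /(alt _ _ oz)[[->]//|[-> _]]; exact: ltW.
- move=> [y [oy dy maxy]].
  have [[_]|[//]] := alt _ _ oy dy.
  by rewrite leNgt KR.
- move=> ->; exists (path 0); split => //; first exact/optimal_path0/ltW.
  move=> z w' oz /(alt _ _ oz)[[_]|[-> //]].
  by rewrite leNgt KR.
Qed.

End planning.

(** * The hyperbolic discount *)

Section hyperbolic.
Variables (R : realType) (T theta reward alpha lambda mu : R).
Hypotheses (halpha : 1 < alpha) (hlambda : 0 < lambda) (hmu : 0 < mu).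

(** With this exponent p, (1 + lambda (s - t))^p is gamma_t(s)^(-1/(alpha - 1)), the shape of the
    optimal speed. *)
Definition hyp_exp : R := mu / (lambda * (alpha - 1)).
(** Equal to lambda (p + 1), the factor produced by differentiating (1 + lambda (s - t))^(p + 1). *)
Definition hyp_rate : R := mu / (alpha - 1) + lambda.
Definition hyp_base (t : R) : R := 1 + lambda * (T - t).
(** The inverse of the integral of the speed profile over [t, T]. As the profile is 1 at [t], this
    is the initial speed per unit of missing progress. *)
Definition hyp_speed (t : R) : R := hyp_rate / (hyp_base t `^ (hyp_exp + 1) - 1).
(* The least cost of a plan that reaches [theta] from [(t, x)], divided by
   [gamma_t(T)], is [(theta - x) `^ alpha * hyp_threshold t]. *)
Definition hyp_threshold (t : R) : R :=
  hyp_speed t `^ (alpha - 1) * hyp_base t `^ (mu / lambda).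

Let am1 : 0 < alpha - 1. Proof. by rewrite subr_gt0. Qed.

Lemma hyp_exp_gt0 : 0 < hyp_exp.
Proof. by rewrite divr_gt0// mulr_gt0. Qed.

Lemma hyp_rate_gt0 : 0 < hyp_rate.
Proof. by rewrite addr_gt0// divr_gt0. Qed.

Lemma hyp_rateE : hyp_rate = lambda * (hyp_exp + 1).
Proof. by rewrite /hyp_rate /hyp_exp; field; rewrite !gt_eqF. Qed.

Lemma hyp_exp_mul : hyp_exp * (alpha - 1) = mu / lambda.
Proof. by rewrite /hyp_exp; field; rewrite !gt_eqF. Qed.

Lemma hyp_base_gt1 t : t < T -> 1 < hyp_base t.
Proof. by move=> tT; rewrite /hyp_base ltrDl mulr_gt0// subr_gt0. Qed.

Lemma hyp_base_gt0 t : t < T -> 0 < hyp_base t.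
Proof. by move=> /hyp_base_gt1; exact: lt_trans. Qed.

Lemma hyp_den_gt0 t : t < T -> 0 < hyp_base t `^ (hyp_exp + 1) - 1.
Proof.
have p1 : 1 `^ (hyp_exp + 1) = 1 :> R by rewrite powR1.
move=> tT; rewrite subr_gt0 -[ltLHS]p1.
apply: gt0_ltr_powR; rewrite ?nnegrE ?ler01 ?hyp_base_gt1 ?addr_gt0 ?hyp_exp_gt0//.
by rewrite ltW// hyp_base_gt0.
Qed.

Lemma hyp_speed_gt0 t : t < T -> 0 < hyp_speed t.
Proof. by move=> tT; rewrite divr_gt0 ?hyp_rate_gt0 ?hyp_den_gt0. Qed.

Lemma hyp_threshold_gt0 t : t < T -> 0 < hyp_threshold t.
Proof. by move=> tT; rewrite mulr_gt0// powR_gt0 ?hyp_speed_gt0 ?hyp_base_gt0. Qed.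

Lemma is_derive_affine_powR (c s a : R) : 0 < 1 + lambda * (s - c) ->
  is_derive s 1 (fun s => (1 + lambda * (s - c)) `^ a)
    (a * (1 + lambda * (s - c)) `^ (a - 1) * lambda).
Proof.
move=> h; pose f s : R := 1 + lambda * (s - c).
have df : is_derive s 1 f lambda.
  rewrite /f; apply: is_derive_eq; rewrite add0r mul1r subr0; exact: mulr1.
by have := @is_derive1_comp _ (fun y : R => y `^ a) f s _ _ (is_derive1_powR a h) df.
Qed.

Lemma chosen_speed_hyperbolic t x v : t < T -> x < theta ->
  chosen_speed T theta reward alpha (hyperbolic_discount lambda mu) t x v <->
  v = if (theta - x) `^ alpha * hyp_threshold t <= reward
      then (theta - x) * hyp_speed t else 0.
Proof.
move=> tT hx.
pose b s : R := 1 + lambda * (s - t).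
pose w s : R := b s `^ hyp_exp.
pose W s : R := (b s `^ (hyp_exp + 1) - 1) / hyp_rate.
have b_gt0 s : t <= s -> 0 < b s.
  by move=> ts; rewrite /b ltr_wpDr// mulr_ge0 ?(ltW hlambda)// subr_ge0.
have bt : b t = 1 by rewrite /b subrr mulr0 addr0.
have bT : b T = hyp_base t by [].
have dW s : t <= s -> is_derive s 1 W (w s).
  move=> ts; have := is_derive_affine_powR (hyp_exp + 1) (b_gt0 _ ts).
  rewrite -/(b s) addrK => d1.
  have d2 : is_derive s 1 (hyp_rate^-1 *: ((fun s => b s `^ (hyp_exp + 1) : R^o) - cst 1)) 
     (hyp_rate^-1 *: ((hyp_exp + 1) * b s `^ hyp_exp * lambda - 0)).
    by apply: is_deriveZ; apply: is_deriveB.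
  have -> : W = hyp_rate^-1 *: ((fun s => b s `^ (hyp_exp + 1) : R^o) - cst 1).
    by apply/funext => r; rewrite /W mulrC.
  apply: is_derive_eq d2 _.
  rewrite subr0 /w [_ *: _](_ : _ = hyp_rate^-1 * ((hyp_exp + 1) * b s `^ hyp_exp * lambda))//.
  rewrite hyp_rateE; field.
  by rewrite !gt_eqF// addr_gt0// hyp_exp_gt0.
have cw : {within `[t, T], continuous w}.
  apply: is_derive_within_continuous => s ts sT.
  exact: (is_derive_affine_powR hyp_exp (b_gt0 _ ts)).
have gammaw s : t <= s -> s <= T -> hyperbolic_discount lambda mu t s * w s `^ (alpha - 1) = 1.
  move=> ts _; rewrite /hyperbolic_discount -/(b s) /w -powRrM hyp_exp_mul powRN mulVf//.
  by rewrite gt_eqF// powR_gt0// b_gt0.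
have mg : measurable_fun setT (hyperbolic_discount lambda mu t).
  rewrite /hyperbolic_discount.
  apply: (@measurableT_comp _ _ _ _ _ _ (fun y : R => y `^ (- (mu / lambda)))) => //.
  by apply: measurable_funD => //; apply: measurable_funM => //; apply: measurable_funB.
have Wt : W t = 0 by rewrite /W bt powR1 subrr mul0r.
rewrite (@chosen_speedP R t T theta reward alpha (hyperbolic_discount lambda mu) w W
  tT halpha _ _ gammaw _ mg cw Wt x hx); last 3 first.
- by move=> s ts _; rewrite powR_gt0// b_gt0.
- by move=> s ts _; rewrite powR_gt0// b_gt0.
- by move=> s ts _; exact: dW.
have WT : W T = (hyp_speed t)^-1 by rewrite /W bT /hyp_speed invf_div.
have u0 := hyp_speed_gt0 tT.
have wt : w t = 1 by rewrite /w bt powR1.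
have x0 : 0 < theta - x by rewrite subr_gt0.
rewrite wt mulr1 WT invrK /hyperbolic_discount -/(b T) bT powRN.
(* In the first test the left side is the effort of the cheapest plan to the goal, the right side
   the discounted reward; the inverse of gamma_t(T) becomes the second factor of [hyp_threshold]. *)
suff -> : (((theta - x) * hyp_speed t) `^ alpha / hyp_speed t <=
    (hyp_base t `^ (mu / lambda))^-1 * reward) =
  ((theta - x) `^ alpha * hyp_threshold t <= reward) by [].
rewrite [(_)^-1 * _]mulrC ler_pdivlMr ?powR_gt0 ?hyp_base_gt0//.
rewrite powRM ?(ltW x0) ?(ltW u0)// (powR_mulr_subr1 alpha u0) /hyp_threshold.
congr (_ <= _); field.
by rewrite gt_eqF.
Qed.

End hyperbolic.

(** * Trajectories *)

Lemma within_continuousW (R : realType) (a b c d : R) (f : R -> R) :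
  a <= c -> d <= b -> {within `[a, b], continuous f} -> {within `[c, d], continuous f}.
Proof.
move=> ac db; apply: continuous_subspaceW => s; rewrite /= !in_itv/= => /andP[cs sd].
by rewrite (le_trans ac cs) (le_trans sd db).
Qed.

(** The point [c] is meant for the giving-up instant, where no equation is available; continuity
    joins the two sides. When no point has to be left out, the lemma is applied with [c = -1],
    outside the interval. *)
Lemma ge0_derive_le_off (R : realType) (a b c : R) (f : R -> R) :
  a <= b -> {within `[a, b], continuous f} ->
  (forall s, a < s -> s < b -> s <> c -> exists2 d, is_derive s 1 f d & 0 <= d) ->
  f a <= f b.
Proof.
have main u v : u <= v -> {within `[u, v], continuous f} ->
    (forall s, u < s -> s < v -> exists2 d, is_derive s 1 f d & 0 <= d) -> f u <= f v.
  move=> uv cf df.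
  have hd s : s \in `]u, v[ -> exists2 d, is_derive s 1 f d & 0 <= d.
    by rewrite in_itv/= => /andP[us sv]; exact: df.
  apply: (@ger0_derive1_le_cc _ f u v) => //; rewrite ?in_itv/= ?lexx ?uv//.
  - by move=> s /hd[d [df' _] _].
  - by move=> s /hd[d [_ df'] d0]; rewrite derive1E df'.
move=> ab cf df.
have [ac|ca] := leP c a.
  by apply: main => // s as_ sb; apply: df => //; apply/eqP; rewrite gt_eqF// (le_lt_trans ac).
have [bc|cb] := leP b c.
  by apply: main => // s as_ sb; apply: df => //; apply/eqP; rewrite lt_eqF// (lt_le_trans sb).
apply: (@le_trans _ _ (f c)); apply: main; rewrite ?(ltW ca) ?(ltW cb)//.
- exact: within_continuousW (ltW cb) cf.
- move=> s as_ sc; apply: df => //; first exact: lt_trans cb.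
  by apply/eqP; rewrite lt_eqF.
- exact: within_continuousW (ltW ca) _ cf.
- move=> s cs sb; apply: df => //; first exact: lt_trans cs.
  by apply/eqP; rewrite gt_eqF.
Qed.

Lemma eq0_derive_eq_off (R : realType) (a b c : R) (f : R -> R) :
  a <= b -> {within `[a, b], continuous f} ->
  (forall s, a < s -> s < b -> s <> c -> is_derive s 1 f 0) -> f b = f a.
Proof.
move=> ab cf df; apply/le_anti/andP; split; last first.
  apply: (@ge0_derive_le_off _ a b c) => // s as_ sb sc.
  by exists 0 => //; exact: df.
rewrite -lerN2.
apply: (@ge0_derive_le_off _ a b c (fun s => - f s)) => //.
  by move=> s; apply: cvgN; exact: cf.
move=> s as_ sb sc; exists 0 => //; have dfs := df s as_ sb sc.
by apply: is_derive_eq; exact: oppr0.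
Qed.

Lemma within_continuous_near (R : realType) (a b x : R) (f : R -> R) :
  {within `[a, b], continuous f} -> a <= x -> x <= b ->
  forall e, 0 < e -> exists2 d, 0 < d &
    forall s, a <= s -> s <= b -> `|s - x| < d -> `|f s - f x| < e.
Proof.
move=> cf ax xb e e0.
have xI : `[a, b]%classic x by rewrite /= in_itv/= ax.
have /subspace_continuousP/(_ x xI) := cf.
move=> /cvgrPdist_lt/(_ e e0); rewrite near_withinE => /nbhs_ballP[d /= d0 H].
exists d => // s as_ sb sx; rewrite distrC; apply: H.
  by rewrite /ball/= distrC.
by rewrite /= in_itv/= as_.
Qed.

Lemma first_hitting (R : realType) (a b c : R) (f : R -> R) :
  a <= b -> {within `[a, b], continuous f} -> f a < c -> c <= f b ->
  exists2 s, a < s <= b & c <= f s /\ forall r, a <= r -> r < s -> f r < c.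
Proof.
move=> ab cf fac cfb.
pose S := [set s | a <= s <= b /\ c <= f s].
have S0 : S !=set0 by exists b; rewrite /S/= ab lexx.
have lbS : has_lbound S by exists a => s [/andP[]].
pose m := inf S.
have am : a <= m by apply: lb_le_inf => // s [/andP[]].
have mb : m <= b by apply: ge_inf => //; rewrite /S/= ab lexx.
have fm : c <= f m.
  rewrite leNgt; apply/negP => fmc.
  have e0 : 0 < c - f m by rewrite subr_gt0.
  have [d d0 H] := within_continuous_near cf am mb e0.
  have [s [/andP[as_ sb] cfs] smd] := inf_adherent d0 (conj S0 lbS).
  have ms : m <= s by apply: ge_inf => //; rewrite /S/= as_ sb.
  have := H s as_ sb; rewrite ger0_norm ?subr_ge0// ltrBlDl => /(_ smd).
  by apply/negP; rewrite -leNgt (le_trans _ (ler_norm _))// lerB.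
exists m; last first.
  split=> // r ar rm; rewrite ltNge; apply/negP => cfr.
  have : m <= r by apply: ge_inf => //; rewrite /S/= ar (le_trans (ltW rm)).
  by rewrite leNgt rm.
rewrite mb andbT lt_neqAle am andbT; apply/eqP => E.
by move: fm; rewrite -E leNgt fac.
Qed.

Lemma last_exit (R : realType) (a b c : R) (f : R -> R) :
  a <= b -> {within `[a, b], continuous f} -> f a <= c -> c < f b ->
  exists2 s, a <= s < b & f s <= c /\ forall r, s < r -> r <= b -> c < f r.
Proof.
move=> ab cf fac cfb.
pose S := [set s | a <= s <= b /\ f s <= c].
have S0 : S !=set0 by exists a; rewrite /S/= ab lexx.
have ubS : has_ubound S by exists b => s [/andP[]].
pose m := sup S.
have mb : m <= b by apply: ge_sup => // s [/andP[]].
have am : a <= m by apply: ub_le_sup => //; rewrite /S/= ab lexx.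
have fm : f m <= c.
  rewrite leNgt; apply/negP => fmc.
  have e0 : 0 < f m - c by rewrite subr_gt0.
  have [d d0 H] := within_continuous_near cf am mb e0.
  have [s [/andP[as_ sb] cfs] smd] := sup_adherent d0 (conj S0 ubS).
  have ms : s <= m by apply: ub_le_sup => //; rewrite /S/= as_ sb.
  have := H s as_ sb; rewrite distrC ger0_norm ?subr_ge0// ltrBlDl -ltrBlDr => /(_ smd).
  by apply/negP; rewrite -leNgt distrC (le_trans _ (ler_norm _))// lerB.
exists m; last first.
  split=> // r mr rb; rewrite ltNge; apply/negP => cfr.
  have : r <= m by apply: ub_le_sup => //; rewrite /S/= rb (le_trans am (ltW mr)).
  by rewrite leNgt mr.
rewrite am/= lt_neqAle mb andbT; apply/eqP => E.
by move: fm; rewrite E leNgt cfb.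
Qed.

Lemma has_derivative_on_near (R : realType) (a b x d : R) (f g : R -> R) :
  (\forall s \near x, a <= s <= b -> f s = g s) -> a <= x <= b ->
  has_derivative_on a b f x d -> has_derivative_on a b g x d.
Proof.
move=> fg axb /cvgrPdist_lt H; apply/cvgrPdist_lt => e /H.
rewrite !near_withinE => H1.
have fgx : f x = g x by exact: (nbhs_singleton fg).
near=> s => sx sab.
have <- : f s = g s.
  have h : a <= s <= b -> f s = g s by near: s.
  by apply: h; move: sab; rewrite /= in_itv/=.
by rewrite -fgx; apply: (near H1 s _).
Unshelve. all: by end_near. Qed.

Lemma has_derivative_onS (R : realType) (a b c x d : R) (f : R -> R) :
  a <= c -> has_derivative_on a b f x d -> has_derivative_on c b f x d.
Proof.
move=> ac /cvgrPdist_lt H; apply/cvgrPdist_lt => e /H.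
rewrite !near_withinE => H1.
near=> s => sx scb; apply: (near H1 s _) => //.
by move: scb; rewrite /= !in_itv/= => /andP[cs ->]; rewrite (le_trans ac cs).
Unshelve. all: by end_near. Qed.

(** * Trajectories for an abstract speed [u] and threshold [h] *)

Section dynamics.
Variables (R : realType) (T theta reward alpha : R) (gamma : R -> R -> R).
Variables (u h Phi : R -> R) (ts : R).
Hypotheses (hT : 0 < T) (htheta : 0 < theta) (halpha : 0 < alpha).
Hypothesis u_gt0 : forall t, t < T -> 0 < u t.
Hypothesis h_gt0 : forall t, t < T -> 0 < h t.
Hypothesis h_incr : forall s t, s < t -> t < T -> h s < h t.
Hypothesis h_cont : forall t, t < T -> {for t, continuous h}.
Hypothesis dPhi : forall t, 0 <= t -> t < T -> is_derive t 1 Phi (u t).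
Hypothesis Phi0 : Phi 0 = 0.
Hypothesis PhiT : forall e, 0 < e -> exists2 b, b < T &
  forall t, 0 <= t -> b <= t -> t < T -> expR (- Phi t) < e.
Hypothesis chosenP : forall t x v, 0 <= t -> t < T -> x < theta ->
  chosen_speed T theta reward alpha gamma t x v <->
  v = if (theta - x) `^ alpha * h t <= reward then (theta - x) * u t else 0.
Hypotheses (ts_ge0 : 0 <= ts) (ts_le : ts <= T).

(* The fraction [1 - x t / theta] still to be done when the agent works until [t]. *)
Definition remaining (t : R) : R := if t < T then expR (- Phi t) else 0.

(** This and the next hypothesis characterize [ts] as the infimum of the times at which the working
    trajectory violates the threshold, or [T] if there are none. The case [r = ts] below covers an
    infimum that is attained. *)
Hypothesis before_ts : forall t, 0 <= t -> t < ts ->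
  (theta * remaining t) `^ alpha * h t <= reward.
Hypothesis after_ts : forall t, ts < t -> t < T -> exists r, [/\ ts <= r, r < t &
  reward < (theta * remaining r) `^ alpha * h r].

Let cf (t : R) : R := theta * (1 - remaining (Num.min t ts)).

Let remaining_ge0 t : 0 <= remaining t.
Proof. by rewrite /remaining; case: ifP => // _; exact: expR_ge0. Qed.

Let remaining_gt0 t : t < T -> 0 < remaining t.
Proof. by rewrite /remaining => ->; exact: expR_gt0. Qed.

Let remainingE t : t < T -> remaining t = expR (- Phi t).
Proof. by rewrite /remaining => ->. Qed.

Let is_derive_remaining t : 0 <= t -> t < T ->
  is_derive t 1 (fun s => expR (- Phi s)) (- (u t * expR (- Phi t))).
Proof.
move=> t0 tT; have dP := dPhi t0 tT.
apply: is_derive_eq.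
by rewrite mulrN mulrC.
Qed.

Let remaining_cont : {within `[0, T], continuous remaining}.
Proof.
apply/subspace_continuousP => t; rewrite /= in_itv/= => /andP[t0 tT].
have [{}tT|] := ltP t T.
  apply: cvg_within_filter.
  have cE : expR (- Phi s) @[s --> t] --> expR (- Phi t).
    exact: is_derive_continuous (is_derive_remaining t0 tT).
  rewrite /from_subspace (remainingE tT).
  apply: cvg_trans cE; apply: near_eq_cvg.
  by near=> s; rewrite /remaining ifT//; near: s; exact: lt_nbhsl.
move=> Tt; have {t0 tT Tt}-> : t = T by apply/le_anti; rewrite tT.
apply/cvgrPdist_lt => e e0; rewrite near_withinE.
have [b bT H] := PhiT e0.
rewrite /from_subspace; have -> : remaining T = 0 by rewrite /remaining ltxx.
near=> s; rewrite /= in_itv/= => /andP[s0 sT].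
rewrite sub0r normrN ger0_norm//.
rewrite /remaining; case: ifP => // sT'; apply: H => //.
by apply/ltW; near: s; exact: lt_nbhsr.
Unshelve. all: by end_near. Qed.

Let remaining_nonincr s t : 0 <= s -> s <= t -> remaining t <= remaining s.
Proof.
move=> s0 st; rewrite {1}/remaining; case: ifP => // tT.
have sT := le_lt_trans st tT.
rewrite remainingE// -lerN2.
apply: (@ge0_derive_le_off _ s t (-1) (fun r => - expR (- Phi r))) => //.
  apply: (@is_derive_within_continuous _ _ (fun r => - - (u r * expR (- Phi r)))) => r sr rt.
  by have := is_derive_remaining (le_trans s0 sr) (le_lt_trans rt tT) => ?; exact: is_deriveN.
move=> r sr rt _; have r0 := le_trans s0 (ltW sr); have rT := lt_trans rt tT.
have dr := is_derive_remaining r0 rT.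
exists (- - (u r * expR (- Phi r))); first exact: is_deriveN.
by rewrite opprK mulr_ge0 ?expR_ge0// ltW// u_gt0.
Qed.

Let remaining0 : remaining 0 = 1.
Proof. by rewrite remainingE// Phi0 oppr0 expR0. Qed.

Let threshold_mono (x y s t : R) : 0 <= y -> y <= x -> 0 < x -> s <= t -> t < T -> 
  y `^ alpha * h s <= x `^ alpha * h t.
Proof.
move=> y0 yx x0; rewrite le_eqVlt => /predU1P[<-|st] tT.
  by rewrite ler_wpM2r ?(ltW (h_gt0 tT))// ge0_ler_powR ?nnegrE ?(ltW x0) ?(ltW halpha).
apply: ler_pM; rewrite ?powR_ge0 ?(ltW (h_gt0 _))//; first exact: lt_trans tT.
  by rewrite ge0_ler_powR ?nnegrE ?(ltW x0) ?(ltW halpha).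
exact/ltW/h_incr.
Qed.

Lemma closed_form_trajectory x : (forall t, 0 <= t <= T -> x t = cf t) ->
  trajectory_off T theta reward alpha gamma [set ts] x.
Proof.
move=> xE; split.
- apply: (@subspace_eq_continuous _ _ _ cf).
    by move=> t; rewrite inE/= in_itv/= => tT; rewrite /from_subspace /= xE.
  apply/subspace_continuousP => t; rewrite /= in_itv/= => /andP[t0 tT].
  apply: cvgM; first exact: cvg_cst.
  apply: cvgB; first exact: cvg_cst.
  apply/cvgrPdist_lt => e e0; rewrite near_withinE.
  have m0 : 0 <= Num.min t ts by rewrite le_min t0.
  have mT : Num.min t ts <= T by rewrite ge_min tT.
  have [d d0 H] := within_continuous_near remaining_cont m0 mT e0.
  apply/nbhs_ballP; exists d => // s /= st /=; rewrite in_itv/= => /andP[s0 sT].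
  rewrite distrC; apply: H; [by rewrite le_min s0|by rewrite ge_min sT|].
  move: st; rewrite /ball/= distrC; apply: le_lt_trans.
  case: (leP s ts) => h1; case: (leP t ts) => h2 //.
  + by rewrite !ler0_norm; lra.
  + by rewrite !ger0_norm; lra.
  + by rewrite subrr normr0.
- by rewrite xE ?lexx ?ltW// /cf (min_idPl _)// remaining0 subrr mulr0.
- move=> t /andP[t0 tT] tts.
  have xt : x t = cf t by rewrite xE// t0 ltW.
  have [lt|] := ltP t ts.
    have minE : Num.min t ts = t by rewrite (min_idPl _)// ltW.
    have xt' : theta - x t = theta * remaining t by rewrite xt /cf minE; ring.
    have xlt : x t < theta by rewrite -subr_gt0 xt' mulr_gt0// remaining_gt0.
    exists ((theta - x t) * u t); last first.
      by apply/(chosenP _ t0 tT xlt); rewrite xt' before_ts.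
    apply: (@has_derivative_on_near _ _ _ _ _ (fun s => theta * (1 - expR (- Phi s)))).
    + near=> s => /andP[s0 sT].
      have sts : s < ts by near: s; exact: lt_nbhsl.
      by rewrite xE ?s0// /cf (min_idPl (ltW sts)) remainingE// (lt_le_trans sts).
    + by rewrite t0 ltW.
    + apply: is_derive_has_derivative_on.
      have dE := is_derive_remaining t0 tT.
      apply: is_derive_eq; rewrite xt' remainingE// add0r mul1r opprK.
      by rewrite [LHS](_ : _ = theta * (u t * expR (- Phi t)))//; ring.
  rewrite le_eqVlt => /predU1P[E|tst]; first by case: tts.
  have tsT : ts < T by exact: lt_trans tT.
  have minE : Num.min t ts = ts by rewrite (min_idPr _)// ltW.
  have xt' : theta - x t = theta * remaining ts by rewrite xt /cf minE; ring.
  have xlt : x t < theta by rewrite -subr_gt0 xt' mulr_gt0// remaining_gt0.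
  exists 0.
    apply: (@has_derivative_on_near _ _ _ _ _ (cst (x t))).
    + near=> s => /andP[s0 sT].
      have sts : ts < s by near: s; exact: lt_nbhsr.
      by rewrite /= xt xE ?s0// /cf minE (min_idPr (ltW sts)).
    + by rewrite t0 ltW.
    + by apply: is_derive_has_derivative_on; exact: is_derive_cst.
  apply/(chosenP _ t0 tT xlt); rewrite ifF//; apply/negbTE; rewrite -ltNge.
  (* The violation occurs on the working trajectory at [r]. The agent stopped at [ts <= r] is at
     least as far from the goal, and [h] has grown by time [t], so the test fails at [t] too. *)
  have [r [tsr rt hr]] := after_ts tst tT.
  apply: lt_le_trans hr _; rewrite xt'.
  apply: threshold_mono => //.
  + by rewrite mulr_ge0// ltW.
  + by rewrite ler_pM2l// remaining_nonincr.
  + by rewrite mulr_gt0// remaining_gt0.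
  + exact: ltW.
Unshelve. all: by end_near. Qed.

(** * Uniqueness of the trajectory *)

Section uniqueness.
Variable x : R -> R.
Hypothesis trajx : trajectory_off T theta reward alpha gamma [set ts] x.

Let cx : {within `[0, T], continuous x}. Proof. by case: trajx. Qed.
Let x0 : x 0 = 0. Proof. by case: trajx. Qed.

Let xP t : 0 <= t -> t < T -> t <> ts -> x t < theta ->
  has_derivative_on 0 T x t
   (if (theta - x t) `^ alpha * h t <= reward then (theta - x t) * u t else 0).
Proof.
move=> t0 tT tts xt; have [_ _ /(_ t)] := trajx; rewrite t0 tT => /(_ erefl tts)[v dv].
by rewrite chosenP// => <-.
Qed.

Let Phi_cont a b : 0 <= a -> b < T -> {within `[a, b], continuous Phi}.
Proof.
move=> a0 bT; apply: (@is_derive_within_continuous _ _ u) => s as_ sb.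
by apply: dPhi; [exact: le_trans as_|exact: le_lt_trans bT].
Qed.

(** The integrating factor of x' = (theta - x) u: this quantity is constant while the agent works
    and increases while it rests below the goal. *)
Let D (t : R) : R := (theta - x t) * expR (Phi t).

Let D_cont a b : 0 <= a -> b < T -> {within `[a, b], continuous D}.
Proof.
move=> a0 bT s; apply: cvgM.
  apply: cvgB; first exact: cvg_cst.
  exact: (within_continuousW a0 (ltW bT) cx).
by apply: continuous_comp; [exact: Phi_cont|exact: continuous_expR].
Qed.

Let D_derive s d : 0 < s -> s < T -> is_derive s 1 x d ->
  is_derive s 1 D (((theta - x s) * u s - d) * expR (Phi s)).
Proof.
move=> s0 sT dx; have dP := dPhi (ltW s0) sT.
apply: is_derive_eq.
rewrite add0r mul1r [LHS](_ : _ =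
  (theta - x s) * (expR (Phi s) * u s) + expR (Phi s) * - d)//; ring.
Qed.

Let D_nondecreasing t : 0 <= t -> t < T ->
  (forall r, 0 <= r -> r < t -> x r < theta) -> D 0 <= D t.
Proof.
move=> t0 tT H; apply: (@ge0_derive_le_off _ 0 t ts) => //; first exact: D_cont.
move=> r r0 rt rts; have rT := lt_trans rt tT.
have xr := H r (ltW r0) rt.
have dx := has_derivative_on_interior r0 rT (xP (ltW r0) rT rts xr).
eexists; first exact: D_derive dx.
rewrite mulr_ge0 ?expR_ge0//; case: ifP => _; first by rewrite subrr.
by rewrite subr0 mulr_ge0 ?subr_ge0 ?(ltW xr)// ltW// u_gt0.
Qed.

(** The law of motion is known only below [theta], so the argument stops at the first time [theta]
    is reached: up to there [D] cannot fall below [D 0 = theta > 0], yet at that time it would be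
    nonpositive. *)
Let x_lt t : 0 <= t -> t < T -> x t < theta.
Proof.
move=> t0 tT; rewrite ltNge; apply/negP => xt.
have x0t : x 0 < theta by rewrite x0.
have [s /andP[s0 st] [xs H]] := first_hitting t0 (within_continuousW (lexx 0) (ltW tT) cx) x0t xt.
have sT := le_lt_trans st tT.
have : D 0 <= D s by apply: D_nondecreasing => //; exact: ltW.
rewrite /D x0 Phi0 expR0 subr0 mulr1 leNgt => /negP; apply.
apply: le_lt_trans htheta; rewrite mulr_le0_ge0 ?expR_ge0//.
by rewrite subr_le0.
Qed.

(** Resting only loses ground: no trajectory is ahead of the one that always works. *)
Let lag t : 0 <= t -> t < T -> theta * remaining t <= theta - x t.
Proof.
move=> t0 tT.
have : D 0 <= D t.
  by apply: D_nondecreasing => // r r0 rt; apply: x_lt => //; exact: lt_trans tT.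
rewrite /D x0 Phi0 expR0 subr0 mulr1 remainingE// expRN ler_pdivrMr//.
exact: expR_gt0.
Qed.

(** The quantity that the agent compares with [reward]. *)
Let M (t : R) : R := (theta - x t) `^ alpha * h t.

Let M_cont a b : 0 <= a -> b < T -> {within `[a, b], continuous M}.
Proof.
move=> a0 bT; apply/subspace_continuousP => s; rewrite /= in_itv/= => /andP[as_ sb].
have sT := le_lt_trans sb bT; have s0 := le_trans a0 as_.
apply: cvgM; last by apply: cvg_within_filter; exact: h_cont.
have th : 0 < theta - x s by rewrite subr_gt0 x_lt.
have /is_derive_continuous cp := is_derive1_powR alpha th.
apply: (@cvg_comp _ _ _ (fun r => theta - x r) (fun y => y `^ alpha) _
  (nbhs (theta - x s))); last exact: cp.
apply: cvgB; first exact: cvg_cst.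
have /subspace_continuousP := within_continuousW a0 (ltW bT) cx; apply.
by rewrite /= in_itv/= as_.
Qed.

Let stopped_cst a b : 0 <= a -> a <= b -> b < T ->
  (forall s, a < s -> s < b -> reward < M s) -> x b = x a.
Proof.
move=> a0 ab bT HM; apply: (@eq0_derive_eq_off _ a b ts) => //.
  exact: within_continuousW a0 (ltW bT) cx.
move=> s as_ sb sts; have s0 := le_lt_trans a0 as_; have sT := lt_trans sb bT.
have := xP (ltW s0) sT sts (x_lt (ltW s0) sT).
rewrite ifF; first exact: has_derivative_on_interior.
by apply/negbTE; rewrite -ltNge; exact: HM.
Qed.

(** Until the first return of [M] to [reward], the state has not moved since [s] while [h] has
    grown, so [M] is still at least [M s]. The passage to [- M] turns this return into an upward
    crossing. *)
Let stopped_absorbing s t : 0 <= s -> s <= t -> t < T -> reward < M s -> reward < M t.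
Proof.
move=> s0 st tT Ms; rewrite ltNge; apply/negP => Mt.
have NM_cont : {within `[s, t], continuous (fun r => - M r)}.
  by move=> r; apply: cvgN; exact: M_cont.
have [||r /andP[sr rt] [Mr H]] := @first_hitting _ s t (- reward) (fun r => - M r) st NM_cont.
- by rewrite ltrN2.
- by rewrite lerN2.
have rT := le_lt_trans rt tT.
have xr : x r = x s.
  apply: stopped_cst => //; first exact: ltW.
  by move=> q sq qr; have := H q (ltW sq) qr; rewrite ltrN2.
move: Mr; rewrite lerN2 leNgt => /negP; apply; apply: (lt_le_trans Ms).
rewrite /M xr; have th : 0 < theta - x s by rewrite subr_gt0 x_lt// (le_lt_trans st).
by apply: threshold_mono; rewrite ?(ltW th) ?(ltW sr).
Qed.

(* At the last working instant before a stop the two-sided derivative would be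
   both positive (still working) and zero (stopped just after). *)
Let working_before t : 0 <= t -> t < ts -> M t <= reward.
Proof.
move=> t0 tts; have tT := lt_le_trans tts ts_le.
rewrite leNgt; apply/negP => Mt.
have M0 : M 0 <= reward.
  have := before_ts (lexx 0) (le_lt_trans t0 tts).
  by rewrite remaining0 mulr1 /M x0 subr0.
have [s /andP[s0 st] [Ms H]] := last_exit t0 (M_cont (lexx 0) tT) M0 Mt.
have sT := lt_trans st tT.
have xs := x_lt s0 sT.
have := xP s0 sT (_ : s <> ts) xs; rewrite -/(M s) Ms => /(_ _).
have sts : s <> ts by apply/eqP; rewrite lt_eqF// (lt_trans st).
move=> /(_ sts) /(has_derivative_onS s0) dx.
have cst_x r : s <= r -> r < t -> x r = cst (x s) r.
  move=> sr rt; rewrite /= (@stopped_cst s r)//; first exact: lt_trans tT.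
  by move=> q sq qr; apply: H => //; exact: ltW (lt_trans qr rt).
have d0 := has_derivative_on_eq st cst_x (lexx s) dx.
have d0' : has_derivative_on s T (cst (x s)) s 0.
  by apply: is_derive_has_derivative_on; exact: is_derive_cst.
have := has_derivative_on_unique (lexx s) sT d0 d0'.
by apply/eqP; rewrite gt_eqF// mulr_gt0 ?u_gt0// subr_gt0.
Qed.

Let x_before t : 0 <= t -> t <= ts -> t < T -> x t = theta * (1 - remaining t).
Proof.
move=> t0 tts tT.
have : D t = D 0.
  apply: (@eq0_derive_eq_off _ 0 t (-1)) => //; first exact: D_cont.
  move=> r r0 rt _; have rT := lt_trans rt tT.
  have rts := lt_le_trans rt tts.
  have rts' : r <> ts by apply/eqP; rewrite lt_eqF.
  have := xP (ltW r0) rT rts' (x_lt (ltW r0) rT).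
  rewrite -/(M r) working_before ?(ltW r0)// => /(has_derivative_on_interior r0 rT).
  by move=> /(D_derive r0 rT); rewrite subrr mul0r.
rewrite /D x0 Phi0 expR0 subr0 mulr1 remainingE// expRN => DE.
have th : theta - x t = theta / expR (Phi t) by rewrite -[X in X / _]DE mulfK ?gt_eqF ?expR_gt0.
by rewrite mulrBr mulr1 -th; ring.
Qed.

(** No equation holds at [T]: the value is the limit of the working formula, in which [remaining]
    tends to 0. *)
Let x_at_T : ts = T -> x T = theta.
Proof.
move=> tsT; apply/eqP; rewrite -subr_eq0 -normr_le0.
apply/ler_addgt0Pr => e e0; rewrite add0r; have e20 : 0 < e / 2 by rewrite divr_gt0.
have [d d0 H] := within_continuous_near cx (ltW hT) (lexx T) e20.
have [b bT Hb] := PhiT (divr_gt0 e20 htheta).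
pose s := Num.max (Num.max 0 b) (T - d / 2).
have sT : s < T by rewrite /s !gt_max hT bT/=; lra.
have s0 : 0 <= s by rewrite /s !le_max lexx.
have bs : b <= s by rewrite /s !le_max lexx orbT.
have ds : T - d / 2 <= s by rewrite /s le_max lexx orbT.
have := H s s0 (ltW sT); rewrite x_before// ?tsT ?(ltW sT)// => h1.
have {}h1 : `|theta * (1 - remaining s) - x T| < e / 2.
  by apply: h1; rewrite distrC ger0_norm; lra.
have := Hb s s0 bs sT; rewrite -(remainingE sT) ltr_pdivlMr// => h2.
have h3 := mulr_ge0 (remaining_ge0 s) (ltW htheta).
move: h1; rewrite ltr_norml => /andP[h4 h5].
by rewrite ler_norml; lra.
Qed.

(** By [lag], a violation of the threshold on the working trajectory is also one on [x], and from
    then on the agent stays stopped. Such violations occur at or after [ts] and before any later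
    time. *)
Let x_after t : ts < t -> t <= T -> x t = x ts.
Proof.
move=> tst tT; have tsT := lt_le_trans tst tT.
apply: (@eq0_derive_eq_off _ ts t ts); first exact: ltW.
  exact: within_continuousW cx.
move=> s tss st sts; have sT := lt_le_trans st tT; have s0 := le_lt_trans ts_ge0 tss.
have := xP (ltW s0) sT sts (x_lt (ltW s0) sT).
rewrite ifF; first exact: has_derivative_on_interior.
apply/negbTE; rewrite -ltNge.
have [r [tsr rs hr]] := after_ts tss sT.
have r0 := le_trans ts_ge0 tsr; have rT := lt_trans rs sT.
apply: (@stopped_absorbing r) => //; first exact: ltW.
apply: lt_le_trans hr _; apply: threshold_mono => //.
- by rewrite mulr_ge0// ltW.
- exact: lag.
- by rewrite subr_gt0 x_lt.
Qed.

Lemma trajectory_closed_form t : 0 <= t <= T -> x t = cf t.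
Proof.
move=> /andP[t0 tT]; rewrite /cf; have [tts|tst] := leP t ts.
  have [{}tT|Tt] := ltP t T; first exact: x_before.
  have tE : t = T by apply/le_anti; rewrite tT.
  have tsE : ts = T by apply/le_anti; rewrite ts_le -tE.
  by rewrite tE x_at_T// /remaining ltxx subr0 mulr1.
rewrite x_after// x_before//.
exact: lt_le_trans tT.
Qed.

End uniqueness.

End dynamics.

(** * The closed form *)

Section eta.
Variables (R : realType) (T theta reward alpha lambda mu : R).
Hypotheses (hT : 0 < T) (htheta : 0 < theta) (hreward : 0 < reward).
Hypotheses (halpha : 1 < alpha) (hlambda : 0 < lambda) (hmu : 0 < mu).
Let mu0 : measure _ _ := @lebesgue_measure R.

Let a0 : 0 < alpha. Proof. exact: lt_trans halpha. Qed.
Let p : R := hyp_exp alpha lambda mu.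
Let k : R := hyp_rate alpha lambda mu.
Let g : R -> R := hyp_base T lambda.
Let u : R -> R := hyp_speed T alpha lambda mu.
Let h : R -> R := hyp_threshold T alpha lambda mu.
Let e (s : R) : R := (g s `^ (p + 1) - 1)^-1.

Let p_gt0 : 0 < p. Proof. exact: hyp_exp_gt0. Qed.
Let k_gt0 : 0 < k. Proof. exact: hyp_rate_gt0. Qed.
Let g_gt1 t : t < T -> 1 < g t. Proof. exact: hyp_base_gt1. Qed.
Let g_gt0 t : t < T -> 0 < g t. Proof. exact: hyp_base_gt0. Qed.
Let den_gt0 t : t < T -> 0 < g t `^ (p + 1) - 1. Proof. exact: hyp_den_gt0. Qed.
Let u_gt0 t : t < T -> 0 < u t. Proof. exact: hyp_speed_gt0. Qed.
Let h_gt0 t : t < T -> 0 < h t. Proof. exact: hyp_threshold_gt0. Qed.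

Let g_decr s t : s < t -> g t < g s.
Proof. by move=> st; rewrite /g /hyp_base ltrD2l ltr_pM2l// ltrD2l ltrN2. Qed.

Let gpow_cont a t : t < T -> {for t, continuous (fun s => g s `^ a)}.
Proof.
move=> tT; have /is_derive_continuous cp := is_derive1_powR a (g_gt0 tT).
apply: (@cvg_comp _ _ _ g (fun y => y `^ a) _ (nbhs (g t))); last exact: cp.
apply: cvgD; first exact: cvg_cst.
apply: cvgM; first exact: cvg_cst.
by apply: cvgB; [exact: cvg_cst|exact: cvg_id].
Qed.

Let e_cont t : t < T -> {for t, continuous e}.
Proof.
move=> tT; apply: cvgV; first by rewrite gt_eqF// den_gt0.
by apply: cvgB; [exact: gpow_cont|exact: cvg_cst].
Qed.

Let u_cont t : t < T -> {for t, continuous u}.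
Proof. by move=> tT; apply: cvgM; [exact: cvg_cst|exact: e_cont]. Qed.

Let h_cont t : t < T -> {for t, continuous h}.
Proof.
move=> tT; apply: cvgM; last exact: gpow_cont.
have /is_derive_continuous cp := is_derive1_powR (alpha - 1) (u_gt0 tT).
by apply: (@cvg_comp _ _ _ u (fun y => y `^ (alpha - 1)) _ (nbhs (u t))); [exact: u_cont|exact: cp].
Qed.

(** In the defining product one factor increases and the other decreases. In this form monotonicity
    is visible: [g] decreases with time, hence so does the denominator. *)
Let hE t : t < T -> h t = (k / (g t - g t `^ (- p))) `^ (alpha - 1).
Proof.
move=> tT; have g0 := g_gt0 tT.
rewrite /h /hyp_threshold -/(u t) -/(g t).
rewrite -(@hyp_exp_mul R alpha lambda mu halpha hlambda) -/p powRrM.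
rewrite -powRM ?powR_ge0 ?(ltW (u_gt0 tT))//; congr (_ `^ _).
rewrite /u /hyp_speed -/k -/p -/(g t).
have -> : g t `^ (p + 1) = g t * g t `^ p by rewrite (powR_mulr_subr1 _ g0) addrK.
have := den_gt0 tT; rewrite (powR_mulr_subr1 _ g0) addrK powRN => d0.
have gp0 : 0 < g t `^ p by rewrite powR_gt0.
have E : g t - (g t `^ p)^-1 = (g t * g t `^ p - 1) / g t `^ p.
  by field; rewrite gt_eqF.
by rewrite E invf_div mulrA -[RHS]mulrA mulrCA; ring.
Qed.

Let h_incr s t : s < t -> t < T -> h s < h t.
Proof.
move=> st tT; have sT := lt_trans st tT.
rewrite !hE//.
have gst := g_decr st.
have gneg : g s `^ (- p) <= g t `^ (- p).
  rewrite !powRN lef_pV2 ?posrE ?powR_gt0 ?g_gt0//.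
  by rewrite ge0_ler_powR ?nnegrE ?(ltW (g_gt0 _))// ?(ltW p_gt0)// ltW.
have den r : r < T -> 0 < g r - g r `^ (- p).
  move=> rT; rewrite subr_gt0; apply: le_lt_trans (g_gt1 rT).
  rewrite powRN invf_le1 ?powR_gt0 ?g_gt0//.
  have p1 : 1 `^ p = 1 :> R by rewrite powR1.
  rewrite -[leLHS]p1 ge0_ler_powR ?nnegrE ?ler01 ?(ltW p_gt0)//.
    by rewrite ltW// g_gt0.
  by rewrite ltW// g_gt1.
apply: gt0_ltr_powR; rewrite ?subr_gt0 ?nnegrE//.
- by rewrite divr_ge0// ltW// den.
- by rewrite divr_ge0// ltW// den.
by rewrite ltr_pM2l// ltf_pV2 ?posrE ?den//; lra.
Qed.

Let e_integrable b : b < T -> mu0.-integrable `[-1, b] (EFin \o e).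
Proof.
move=> bT; apply: continuous_compact_integrable; first exact: segment_compact.
apply/subspace_continuousP => s; rewrite /= in_itv/= => /andP[_ sb].
by apply: cvg_within_filter; apply: e_cont; exact: le_lt_trans bT.
Qed.

(* The primitive starts at -1 so that it is differentiable at 0. *)
Let I (t : R) : R := \int[mu0]_(s in `[-1, t]) e s.
Let Phi (t : R) : R := k * (I t - I 0).

Let dPhi t : 0 <= t -> t < T -> is_derive t 1 Phi (u t).
Proof.
move=> t0 tT; have tb : t < (t + T) / 2 by lra.
have bT : (t + T) / 2 < T by lra.
have t1 : -1 < t by lra.
have [dI IE] := continuous_FTC1_closed tb (e_integrable bT) t1 (e_cont tT).
have dI' : is_derive t 1 I (e t).
  by apply: DeriveDef => //; rewrite -derive1E; apply: IE; lra.
by apply: is_derive_eq; rewrite subr0.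
Qed.

Let Phi0 : Phi 0 = 0. Proof. by rewrite /Phi subrr mulr0. Qed.

Let etaE t : 0 <= t -> t < T -> Defs.eta T alpha lambda mu t = (Phi t / k)%:E.
Proof.
move=> t0 tT; have it := e_integrable tT.
have i0 : mu0.-integrable `[0, t] (EFin \o e).
  apply: integrableS it; [exact: measurable_itv|exact: measurable_itv|].
  by move=> s; rewrite /= !in_itv/= => /andP[s0 ->]; rewrite andbT; lra.
rewrite /Phi mulrC mulrA mulVf ?gt_eqF// mul1r /I Rintegral_itvB ?bnd_simp//.
rewrite Rintegral_itv_obnd_cbnd; last first.
  apply: integrableS i0; [exact: measurable_itv|exact: measurable_itv|].
  by move=> s; rewrite /= !in_itv/= => /andP[/ltW -> ->].
by rewrite /Rintegral fineK//; apply: integrable_fin_num.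
Qed.

(** The tangent to the power p + 1 at [g t], evaluated at 1, bounds the denominator of [u] by (p +
    1) g(t)^p (g(t) - 1), which is k g(t)^p (T - t). This growth like 1 / (T - t) is what makes
    [Phi] diverge. *)
Let u_lower t : 0 <= t -> t < T -> (g 0 `^ p)^-1 / (T - t) <= u t.
Proof.
move=> t0 tT; have g0 := g_gt0 tT; have Tt : 0 < T - t by rewrite subr_gt0.
have gp0 : 0 < g 0 `^ p by rewrite powR_gt0// g_gt0.
rewrite -invfM /u /hyp_speed -/k -/p -/(g t).
rewrite -[leLHS]mul1r ler_pdivrMr ?mulr_gt0// mulrAC ler_pdivlMr ?den_gt0// mul1r.
have p1 : 1 < p + 1 by rewrite ltrDr.
have := powR_tangent p1 (ltW g0) ler01; rewrite powR1 addrK => tang.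
have gt0 : g t `^ p <= g 0 `^ p.
  rewrite ge0_ler_powR ?nnegrE ?(ltW p_gt0) ?(ltW g0) ?(ltW (g_gt0 hT))//.
  by move: t0; rewrite le_eqVlt => /predU1P[<-//|t0]; rewrite ltW// g_decr.
have kE : k = lambda * (p + 1) by exact: hyp_rateE.
have gE : g t - 1 = lambda * (T - t) by rewrite /g /hyp_base; ring.
apply: (@le_trans _ _ ((p + 1) * g t `^ p * (g t - 1))); first by lra.
rewrite gE kE [leLHS](_ : _ = (lambda * (p + 1) * (T - t)) * g t `^ p); last by ring.
rewrite [leRHS](_ : _ = (lambda * (p + 1) * (T - t)) * g 0 `^ p); last by ring.
by rewrite ler_wpM2l// !mulr_ge0// ?(ltW Tt) ?(ltW hlambda)// ltW// addr_gt0.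
Qed.

Let PhiT (d : R) : 0 < d -> exists2 b, b < T &
  forall t, 0 <= t -> b <= t -> t < T -> expR (- Phi t) < d.
Proof.
move=> d0; pose a := (g 0 `^ p)^-1.
have a_gt0 : 0 < a by rewrite invr_gt0 powR_gt0// g_gt0.
have lower t : 0 <= t -> t < T -> a * (ln T - ln (T - t)) <= Phi t.
  move=> t0 tT.
  have dln s : s < T -> is_derive s 1 (fun r => ln (T - r)) (- (T - s)^-1).
    move=> sT; have Ts : 0 < T - s by rewrite subr_gt0.
    have d1 : is_derive s 1 (fun r : R => T - r) (-1).
      by apply: is_derive_eq; rewrite add0r mul1r.
    have := @is_derive1_comp _ (@ln R) (fun r => T - r) s _ _ (is_derive1_ln Ts) d1.
    by rewrite mulrN1.
  have dF s : 0 <= s -> s < T ->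
      is_derive s 1 (fun r => Phi r + a * ln (T - r)) (u s - a / (T - s)).
    move=> s0 sT; have d1 := dPhi s0 sT; have d2 := dln s sT.
    by apply: is_derive_eq; rewrite [_ *: _](_ : _ = a * - (T - s)^-1)// mulrN.
  (* By [u_lower] the derivative of [Phi r + a * ln (T - r)] is nonnegative. *)
  have : Phi 0 + a * ln (T - 0) <= Phi t + a * ln (T - t).
    apply: (@ge0_derive_le_off _ 0 t (-1) (fun r => Phi r + a * ln (T - r))) => //.
      apply: (@is_derive_within_continuous _ _ (fun s => u s - a / (T - s))) => s s0 st.
      by apply: dF => //; exact: le_lt_trans tT.
    move=> s s0 st _; have sT := lt_trans st tT.
    exists (u s - a / (T - s)); first exact: dF (ltW s0) sT.
    by rewrite subr_ge0 u_lower// ltW.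
  by rewrite Phi0 subr0; lra.
(* Chosen so that a (ln T - l) = - ln d. Halving [expR l] in the witness makes [ln (T - t) < l]
   strict. *)
pose l := ln T + ln d / a.
exists (T - expR l / 2); first by rewrite ltrBlDr ltrDl divr_gt0// expR_gt0.
move=> t t0 bt tT; apply: (@le_lt_trans _ _ (expR (- (a * (ln T - ln (T - t)))))).
  by rewrite ler_expR lerN2 lower.
rewrite -[ltRHS](lnK d0) ltr_expR.
have Tt : 0 < T - t by rewrite subr_gt0.
have : ln (T - t) < l.
  rewrite -[ltRHS]expRK ltr_ln ?posrE ?expR_gt0//.
  by have := expR_gt0 l; lra.
rewrite /l -ltrBlDl ltr_pdivlMr// => hl; nra.
Qed.

(** A finite value would bound [Phi] on [0, T[, against [PhiT]. *)
Let eta_T : Defs.eta T alpha lambda mu T = +oo%E.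
Proof.
have e_ge0 s : s <= T -> 0 <= e s.
  rewrite le_eqVlt => /predU1P[->|sT]; last by rewrite invr_ge0 ltW// den_gt0.
  (* At [T] itself the denominator vanishes and total division gives 0, so the integrand is still
     nonnegative. *)
  by rewrite /e /g /hyp_base subrr mulr0 addr0 powR1 subrr invr0.
have mono t : 0 <= t -> t < T -> ((Phi t / k)%:E <= Defs.eta T alpha lambda mu T)%E.
  move=> t0 tT; rewrite -etaE//.
  apply: ge0_le_integral_nonmeasurable => //.
  - by move=> s; rewrite /= !in_itv/= => /andP[-> st]; rewrite (le_trans st (ltW tT)).
  - by move=> s; rewrite /= in_itv/= => /andP[_ sT]; rewrite lee_fin; exact: e_ge0.
  - move=> s; rewrite /= in_itv/= => /andP[_ sT]; rewrite lee_fin.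
    exact: e_ge0 (le_trans sT (ltW tT)).
move E : (Defs.eta T alpha lambda mu T) mono => [r| |] mono //; last first.
  by have := mono 0 (lexx 0) hT.
have [b bT H] := PhiT (expR_gt0 (- (k * r))).
pose t := Num.max 0 b.
have t0 : 0 <= t by rewrite /t le_max lexx.
have tT : t < T by rewrite /t gt_max hT.
have bt : b <= t by rewrite /t le_max lexx orbT.
have := H t t0 bt tT; rewrite ltr_expR ltrN2 => h1.
have := mono t t0 tT; rewrite lee_fin ler_pdivrMr// => h2.
by move: h1; rewrite mulrC ltNge h2.
Qed.

Let expeR_eta t : 0 <= t -> t <= T ->
  fine (expeR (- (k%:E * Defs.eta T alpha lambda mu t)))%E = remaining T Phi t.
Proof.
move=> t0; rewrite le_eqVlt /remaining => /predU1P[->|tT].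
  by rewrite ltxx eta_T gt0_muley ?lte_fin.
by rewrite tT etaE// -EFinM /= mulrC mulfVK ?gt_eqF.
Qed.

Let fTE t : 0 <= t -> t < T ->
  fT T alpha lambda mu t = h t * remaining T Phi t `^ alpha.
Proof.
move=> t0 tT; rewrite /fT /h /hyp_threshold /remaining tT; congr (_ * _ * _).
  congr (_ `^ _); rewrite /hyp_speed /hyp_rate.
  have d0 := den_gt0 tT; rewrite /g /p /hyp_base /hyp_exp in d0 *.
  have am1 : 0 < alpha - 1 by rewrite subr_gt0.
  by field; rewrite !gt_eqF.
rewrite etaE// -EFinM /= -expRM; congr expR.
by rewrite -/(hyp_rate alpha lambda mu) -/k; field; rewrite gt_eqF.
Qed.

Let fT_T : fT T alpha lambda mu T = 0.
Proof.
rewrite /fT eta_T gt0_muley ?lte_fin; last by rewrite mulr_gt0.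
by rewrite /= mulr0.
Qed.

Let ts : R := tstar T theta reward alpha lambda mu.
Let give : set R := give_up_times T theta reward alpha lambda mu.

Let giveP t : give t <-> [/\ 0 <= t, t < T &
  reward < (theta * remaining T Phi t) `^ alpha * h t].
Proof.
have tha : 0 < theta `^ alpha by rewrite powR_gt0.
have rE s : 0 <= s -> s < T -> (reward / theta `^ alpha < fT T alpha lambda mu s) =
    (reward < (theta * remaining T Phi s) `^ alpha * h s).
  move=> s0 sT; rewrite fTE// ltr_pdivrMr// powRM ?(ltW htheta)//; last first.
    by rewrite /remaining sT expR_ge0.
  by congr (_ < _); ring.
split=> [[/andP[t0 tT]]|[t0 tT]].
(* [T] is never a time of giving up: [fT] vanishes there, while the ratio of reward to theta^alpha
   is positive. *)
- move: tT; rewrite le_eqVlt => /predU1P[->|tT]; last by rewrite rE.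
  by rewrite fT_T ltNge ltW// divr_gt0.
- by rewrite -rE// => ?; split => //; rewrite t0 ltW.
Qed.

Let lb_give : has_lbound give. Proof. by exists 0 => t /giveP[]. Qed.

Let tsE : (give !=set0 /\ ts = inf give) \/ ((forall t, ~ give t) /\ ts = T).
Proof.
rewrite /ts /tstar; case: asboolP => H.
- by left; split => //; case: H => t; exists t.
- by right; split => // t gt; apply: H; exists t.
Qed.

Let ts_ge0 : 0 <= ts.
Proof.
case: tsE => [[g0 ->]|[_ ->]]; last exact: ltW.
by apply: lb_le_inf => // t /giveP[].
Qed.

Let ts_le : ts <= T.
Proof.
case: tsE => [[[t gt] ->]|[_ ->]] //.
by apply: le_trans (ge_inf lb_give gt) _; case/giveP : gt => _ /ltW.
Qed.

Let before_ts t : 0 <= t -> t < ts ->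
  (theta * remaining T Phi t) `^ alpha * h t <= reward.
Proof.
move=> t0 tts; rewrite leNgt; apply/negP => H.
have gt : give t by apply/giveP; split => //; exact: lt_le_trans ts_le.
case: tsE => [[_ E]|[/(_ t)//]].
by move: tts; rewrite E ltNge (ge_inf lb_give gt).
Qed.

Let after_ts t : ts < t -> t < T -> exists r, [/\ ts <= r, r < t &
  reward < (theta * remaining T Phi r) `^ alpha * h r].
Proof.
move=> tst tT; case: tsE => [[g0 E]|[_ E]]; last first.
  by move: (lt_trans tst tT); rewrite E ltxx.
have [r gr rt] : exists2 r, give r & r < t by apply: inf_lt; rewrite -?E.
exists r; split => //; first by rewrite E; exact: ge_inf.
by case/giveP : gr.
Qed.

Let closed_formE t : 0 <= t <= T -> closed_form T theta reward alpha lambda mu t =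
  theta * (1 - remaining T Phi (Num.min t ts)).
Proof.
move=> /andP[t0 tT]; rewrite /closed_form -/(hyp_rate alpha lambda mu) -/k expeR_eta//.
- by rewrite le_min t0.
- by rewrite ge_min tT.
Qed.

Lemma trajectory_closed_formP x :
  trajectory_off T theta reward alpha (hyperbolic_discount lambda mu)
    [set tstar T theta reward alpha lambda mu] x <->
  (forall t : R, 0 <= t <= T ->
     x t = closed_form T theta reward alpha lambda mu t).
Proof.
have chosenP t x' v : 0 <= t -> t < T -> x' < theta ->
    chosen_speed T theta reward alpha (hyperbolic_discount lambda mu) t x' v <->
    v = if (theta - x') `^ alpha * h t <= reward then (theta - x') * u t else 0.
  by move=> _ tT xt; exact: chosen_speed_hyperbolic.
split.
- move=> trajx t tT; rewrite closed_formE//.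
  exact: (trajectory_closed_form hT htheta a0 u_gt0 h_gt0 h_incr h_cont dPhi Phi0 PhiT
    chosenP ts_ge0 ts_le before_ts after_ts trajx).
- move=> xE.
  apply: (closed_form_trajectory hT htheta a0 u_gt0 h_gt0 h_incr dPhi Phi0 PhiT
    chosenP ts_ge0 ts_le before_ts after_ts).
  by move=> t tT; rewrite xE// closed_formE.
Qed.

End eta.

Unset Implicit Arguments.

Theorem theorem3 (R : realType) (T theta reward alpha lambda mu : R)
    (hT : 0 < T) (htheta : 0 < theta) (hreward : 0 < reward)
    (halpha : 1 < alpha) (hlambda : 0 < lambda) (hmu : 0 < mu) (x : R -> R) :
  trajectory_off T theta reward alpha (hyperbolic_discount lambda mu)
    [set tstar T theta reward alpha lambda mu] x <->
  (forall t : R, 0 <= t <= T ->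
     x t = closed_form T theta reward alpha lambda mu t).
Proof. exact: trajectory_closed_formP. Qed.
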